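(* Let $(X_t^{(n)})_{n\ge1}$ be a sequence of lazy irreducible discrete-time birth-and-death chains, with mixing times $t_{\mathrm{mix}}^{(n)}(\cdot)$, spectral gaps $\mathrm{gap}(n)$ and relaxation times $t_{\mathrm{rel}}^{(n)}$. Then the sequence exhibits cutoff in total-variation distance if and only if $t_{\mathrm{mix}}^{(n)}(\frac14)\cdot\mathrm{gap}(n)\to\infty$ as $n\to\infty$. Furthermore, the cutoff window is at most the geometric mean of the mixing time and the relaxation time: when cutoff occurs, $w_n=\sqrt{t_{\mathrm{mix}}^{(n)}(\frac14)\cdot t_{\mathrm{rel}}^{(n)}}$ is a cutoff window for the sequence.
   Context: A (discrete-time) birth-and-death chain is a Markov chain with state space $\Omega=\{0,\ldots,N\}$ for some integer $N\ge1$ (which may differ from chain to chain) whose transition kernel $P$ satisfies $P(x,y)=0$ whenever $|x-y|>1$. It is lazy if $P(x,x)\ge\frac12$ for all $x\in\Omega$. Let $\pi$ be the stationary distribution. With $\|\mu-\nu\|_{\mathrm{TV}}=\frac12\sum_x|\mu(x)-\nu(x)|$, put $d(t)=\max_{x\in\Omega}\|P^t(x,\cdot)-\pi\|_{\mathrm{TV}}$ for integers $t\ge 0$ and $t_{\mathrm{mix}}(\epsilon)=\min\{t:d(t)\le\epsilon\}$ for $0<\epsilon<1$. The spectral gap is $\mathrm{gap}=1-\lambda$, where $\lambda$ is the largest absolute value of all nontrivial eigenvalues of $P$, and $t_{\mathrm{rel}}=\mathrm{gap}^{-1}$. A superscript $(n)$ or argument $n$ indicates the quantity for the $n$-th chain.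 The sequence exhibits cutoff (in total variation) if $\lim_{n\to\infty} t_{\mathrm{mix}}^{(n)}(\epsilon)/t_{\mathrm{mix}}^{(n)}(1-\epsilon)=1$ for every $0<\epsilon<1$. A sequence $w_n$ is a cutoff window for the sequence of chains if $w_n=o\big(t_{\mathrm{mix}}^{(n)}(\frac14)\big)$ and for every $\epsilon\in(0,1)$ there is $c_\epsilon>0$ such that $t_{\mathrm{mix}}^{(n)}(\epsilon)-t_{\mathrm{mix}}^{(n)}(1-\epsilon)\le c_\epsilon w_n$ for all $n$. *)

(* Defs.v *)
From HB Require Import structures.
From mathcomp Require Import all_boot all_order all_algebra.
From mathcomp Require Import complex.
From mathcomp Require Import boolp classical_sets reals topology normedtype.
From mathcomp Require Import landau.

Set Implicit Arguments.
Unset Strict Implicit.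
Unset Printing Implicit Defensive.

Import Order.TTheory GRing.Theory Num.Theory.
Import numFieldNormedType.Exports.

Local Open Scope classical_set_scope.
Local Open Scope ring_scope.

(* A chain on the state space {0, ..., N} is given by its transition kernel
   [P : 'M[R]_N.+1]; distributions on the state space are row vectors. *)

Section Chain.
Variables (R : realType) (N : nat).
Implicit Types (P : 'M[R]_N.+1) (mu nu pi : 'rV[R]_N.+1).

Definition stochastic P : Prop :=
  (forall x y, 0 <= P x y) /\ (forall x, \sum_y P x y = 1).

Definition birth_death P : Prop :=
  [/\ (1 <= N)%N, stochastic P &
      forall x y : 'I_N.+1, (x.+1 < y)%N || (y.+1 < x)%N -> P x y = 0].

Definition lazy P : Prop := forall x, 2^-1 <= P x x.

Definition irreducible P : Prop := forall x y, exists t : nat, 0 < (P ^+ t) x y.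

Definition stationary_distribution P pi : Prop :=
  [/\ forall x, 0 <= pi 0 x, \sum_x pi 0 x = 1 & pi *m P = pi].

Definition tv_dist mu nu : R := 2^-1 * \sum_x `|mu 0 x - nu 0 x|.

Definition dist_to_stationarity P pi (t : nat) : R :=
  \big[Num.max/0]_x tv_dist (row x (P ^+ t)) pi.

(* The fallback value 0 is irrelevant for a lazy irreducible chain, for which
   the distance to stationarity tends to 0. *)
Definition t_mix P pi (eps : R) : nat :=
  match pselect (exists t, dist_to_stationarity P pi t <= eps) with
  | left ex_t => ex_minn ex_t
  | right _ => 0%N
  end.

(* Nontrivial means different from 1, the eigenvalue 1 of an irreducible
   stochastic matrix being simple. Eigenvalues are taken in [R[i]]. *)
Definition nontrivial_eigenvalue P (z : R[i]) : bool :=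
  eigenvalue (map_mx (real_complex R) P) z && (z != 1).

(* The supremum is a maximum: the set is finite, and it is nonempty when P is
   irreducible and 1 <= N. *)
Definition gap P : R :=
  1 - sup [set Normc.normc z | z in [set z | nontrivial_eigenvalue P z]].

Definition t_rel P : R := (gap P)^-1.

End Chain.

Section Cutoff.
Variables (R : realType) (tmix : nat -> R -> nat).

(* Division by 0 yields 0, so convergence of the ratio to 1 forces
   [tmix n (1 - eps)] to be nonzero for all large n. *)
Definition cutoff : Prop :=
  forall eps : R, 0 < eps < 1 ->
    (fun n => (tmix n eps)%:R / (tmix n (1 - eps))%:R : R) @ \oo --> (1 : R).

Definition cutoff_window (w : nat -> R) : Prop :=
  (w : nat -> R^o) =o_\oo (fun n => (tmix n 4^-1)%:R : R^o) /\
  forall eps : R, 0 < eps < 1 ->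
    exists2 c : R, 0 < c &
      forall n, (tmix n eps)%:R - (tmix n (1 - eps))%:R <= c * w n.

End Cutoff.

(* Main.v *)
(* For the chain started at 0 put D(t,j) = pi(>= j) - P^t(0, >= j) and h(j) = pi(>= j). The quotient
   G(t,j) = D(t,j) / h(j) is the probability that a birth-and-death chain started at j (the Doob
   transform by h of the Siegmund dual of P) is not yet absorbed at 0 at time t. Its killed
   Poincare constant is at most t_rel, because it comes from that of P by duality. The passage
   time from i to i - 1 then has variance at most 2 t_rel times its mean, so the absorption time
   from j has mean m and variance at most 2 t_rel m, and Chebyshev's inequality makes G(.,j) drop
   from near 1 to near 0 in a time of order sqrt(t_rel m).

   Take for j a low quantile of pi. Then G(t,j) is a lower bound for the distance to stationarity
   up to a factor close to 1, and also, up to a small error and a delay of order t_rel, an upper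
   bound for the deviation of the tails of P^t(0,.): x |-> P^s(x, >= k) is increasing, and by the
   L2 contraction it is close to pi(>= k) at some point below the quantile, hence at the quantile.
   Since P is totally positive of order 2, the distance to stationarity is at most the sum of the
   tail deviations from the two endpoints. This bounds the window by sqrt(t_mix t_rel) for every
   chain. Conversely, 2 d(t) >= (1 - gap)^t and laziness forbid cutoff when t_mix gap is bounded. *)

Require Import Defs.
From HB Require Import structures.
From mathcomp Require Import all_boot all_order all_algebra.
From mathcomp Require Import boolp classical_sets reals topology normedtype.
From mathcomp Require Import complex landau sequences exp.
From mathcomp Require Import zify ring lra.

Set Implicit Arguments.
Unset Strict Implicit.
Unset Printing Implicit Defensive.

Import Order.TTheory GRing.Theory Num.Theory.
Import numFieldNormedType.Exports.

Local Open Scope classical_set_scope.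
Local Open Scope ring_scope.

(** * Absorption times of killed birth-and-death chains *)

Section KilledBirthDeath.
Variables (R : realFieldType) (N : nat) (a b rho : nat -> R) (K : R).
Hypothesis a_gt0 : forall j, (0 < j <= N)%N -> 0 < a j.
Hypothesis b_ge0 : forall j, (0 < j <= N)%N -> 0 <= b j.
Hypothesis bN : b N = 0.
Hypothesis ab_le1 : forall j, (0 < j <= N)%N -> a j + b j <= 1.
Hypothesis rho_gt0 : forall j, (0 < j <= N)%N -> 0 < rho j.
Hypothesis balance : forall j, (0 < j < N)%N -> rho j * b j = rho j.+1 * a j.+1.
Hypothesis K_gt0 : 0 < K.
Hypothesis poincare : forall f : nat -> R, f 0%N = 0 ->
  \sum_(1 <= i < N.+1) rho i * f i ^+ 2
    <= K * \sum_(1 <= i < N.+1) rho i * a i * (f i - f i.-1) ^+ 2.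

(* [al i] is the mean passage time from [i] to [i - 1] and [S i] bounds its variance; [u j] is
   the mean absorption time from [j] and [v j] bounds its variance. *)
Let tailsum (F : nat -> R) i := \sum_(i <= l < N.+1) F l.
Let c i := rho i * a i.
Let mass := tailsum rho.
Let al i := mass i / c i.
Let energy := tailsum (fun l => c l * al l ^+ 2).
Let S i := (energy i *+ 2 - c i * al i ^+ 2) / c i.
Let u j := \sum_(1 <= i < j.+1) al i.
Let v j := \sum_(1 <= i < j.+1) S i.

Let c_gt0 j : (0 < j <= N)%N -> 0 < c j.
Proof. by move=> jN; rewrite mulr_gt0 ?a_gt0 ?rho_gt0. Qed.

Let tailsumS F i : (i <= N)%N -> tailsum F i = F i + tailsum F i.+1.
Proof. by move=> iN; rewrite /tailsum big_ltn. Qed.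

Let tailsum_ge0 F i : (0 < i)%N ->
  (forall l, (0 < l <= N)%N -> 0 <= F l) -> 0 <= tailsum F i.
Proof.
move=> i0 F0; rewrite /tailsum big_nat; apply: sumr_ge0 => l /andP[il lN].
by apply: F0; rewrite (leq_trans i0 il).
Qed.

Let mass_ge0 i : (0 < i)%N -> 0 <= mass i.
Proof. by move=> i0; apply: tailsum_ge0 => // l lN; exact/ltW/rho_gt0. Qed.

Let al_ge0 i : (0 < i <= N)%N -> 0 <= al i.
Proof.
move=> /[dup] iN /andP[i0 _].
by rewrite divr_ge0 ?mass_ge0 ?(ltW (c_gt0 iN)).
Qed.

Let mass_c i : (0 < i <= N)%N -> c i * al i = mass i.
Proof. by move=> /c_gt0 ci; rewrite mulrC divfK ?gt_eqF. Qed.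

(** [f l] is the mean passage time from [l] to [i - 1]. Its Dirichlet form is [energy i], which is
    also the sum of [rho l * f l] because [c i * al i] is the mass from [i] on. Cauchy-Schwarz and
    Poincare bound the square of that sum by [mass i * (K * energy i)]. *)
Let energy_le i : (0 < i <= N)%N -> energy i <= K * mass i.
Proof.
move=> /andP[i0 iN].
pose f l := \sum_(1 <= m < l.+1 | (i <= m)%N) al m.
have fS l : (0 < l)%N -> f l - f l.-1 = if (i <= l)%N then al l else 0.
  case: l => // l _; rewrite /f big_mkcond big_nat_recr //= -big_mkcond.
  by rewrite addrAC subrr add0r.
have f_lt l : (l < i)%N -> f l = 0.
  move=> li; rewrite /f big_nat_cond big_pred0 // => m.
  apply/negP => /andP[/andP[_ ml] im].
  by move: (leq_ltn_trans (leq_trans im ml) li); rewrite ltnn.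
have widen (F : nat -> R) : tailsum F i = \sum_(1 <= l < N.+1 | (i <= l)%N) F l.
  by rewrite /tailsum (big_nat_widenl _ 1).
have massE : mass i = \sum_(1 <= l < N.+1) if (i <= l)%N then rho l else 0.
  by rewrite /mass widen big_mkcond.
have E1 : energy i = \sum_(1 <= l < N.+1) c l * (f l - f l.-1) ^+ 2.
  rewrite /energy widen big_mkcond big_nat [RHS]big_nat.
  apply: eq_bigr => l /andP[l0 _]; rewrite fS //.
  by case: ifP => // _; rewrite expr0n mulr0.
have E2 : energy i = \sum_(1 <= l < N.+1) rho l * f l.
  rewrite /energy widen big_mkcond.
  pose B l m := if (i <= l)%N && (l <= m)%N then rho m * al l else 0.
  transitivity (\sum_(1 <= l < N.+1) \sum_(1 <= m < N.+1) B l m).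
    rewrite big_nat [RHS]big_nat; apply: eq_bigr => l /andP[l0 lN].
    rewrite /B; case: ifP => il /=; last by rewrite big1.
    rewrite expr2 mulrA mass_c ?l0 // mulr_suml (big_nat_widenl _ 1) //.
    by rewrite -big_mkcond.
  rewrite exchange_big_nat; apply: eq_big_nat => m /andP[m0 mN].
  rewrite mulr_sumr (big_nat_widen 1 m.+1 N.+1) //.
  by rewrite [RHS]big_mkcond; apply: eq_bigr => l _; rewrite /B ltnS.
have F2 : \sum_(1 <= l < N.+1) rho l * f l ^+ 2 <= K * energy i.
  by rewrite E1; apply: poincare; rewrite /f big_geq.
suff : energy i <= (energy i + K * mass i) / 2 by lra.
(* AM-GM: [f <= f^2 / (2 K) + K / 2] *)
rewrite {1}E2 ler_pdivlMr // mulr_suml -(ler_pM2l K_gt0).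
have -> : K * (energy i + K * mass i) = K * energy i + K ^+ 2 * mass i by ring.
apply: (le_trans _ (lerD F2 (lexx _))) => {F2 E1 E2}.
rewrite massE !mulr_sumr -big_split /= !big_nat.
apply: ler_sum => l /andP[l0 lN].
case: ifP => [_|/negbT]; last first.
  by rewrite -ltnNge => /f_lt ->; rewrite expr0n !mulr0 mul0r !mulr0 addr0.
have := rho_gt0 (j := l); rewrite l0 -ltnS lN => /(_ isT) r0.
rewrite -subr_ge0.
have -> : rho l * f l ^+ 2 + K ^+ 2 * rho l - K * (rho l * f l * 2) =
  rho l * (f l - K) ^+ 2 by ring.
by rewrite mulr_ge0 ?sqr_ge0 ?ltW.
Qed.

Let drift_u j : (0 < j <= N)%N -> a j * al j - b j * al j.+1 = 1.
Proof.
move=> /[dup] jN /andP[j0 jleN].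
have r0 := rho_gt0 jN; apply: (mulfI (lt0r_neq0 r0)).
rewrite mulr1 mulrBr (mulrA _ (a j)) (mulrA _ (b j)).
rewrite -[rho j * a j]/(c j) mass_c // /mass tailsumS //.
case: (ltngtP j N) jleN => // [jlt _|-> _].
  by rewrite balance ?j0 // -[X in X * _]/(c j.+1) mass_c //= addrK.
by rewrite bN mulr0 mul0r /tailsum big_geq // addr0 subr0.
Qed.

(** [S] is the solution of this recursion: the drift of [v] cancels the second moment, rather than
    the variance, of an increment of [u]. *)
Let drift_v j : (0 < j <= N)%N ->
  a j * S j - b j * S j.+1 = a j * al j ^+ 2 + b j * al j.+1 ^+ 2.
Proof.
move=> /[dup] jN /andP[j0 jleN].
have r0 := rho_gt0 jN; apply: (mulfI (lt0r_neq0 r0)).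
rewrite mulrBr mulrDr !(mulrA _ (a j)) !(mulrA _ (b j)).
have cS i : (0 < i <= N)%N -> c i * S i = energy i *+ 2 - c i * al i ^+ 2.
  by move=> /c_gt0 ci; rewrite mulrC divfK ?gt_eqF.
rewrite -[rho j * a j]/(c j) cS // /energy tailsumS // -/energy.
case: (ltngtP j N) jleN => // [jlt _|-> _].
  rewrite balance ?j0 // -[rho _ * a _]/(c j.+1) cS //= -/(energy j.+1); ring.
have -> : energy N.+1 = 0 by rewrite /energy /tailsum big_geq.
rewrite bN; ring.
Qed.

Let S_ge0 i : (0 < i <= N)%N -> 0 <= S i.
Proof.
move=> /[dup] iN /andP[i0 ileN]; rewrite divr_ge0 ?(ltW (c_gt0 iN)) //.
rewrite /energy tailsumS // -/(energy _).
have: 0 <= energy i.+1.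
  by apply: tailsum_ge0 => // l lN; rewrite mulr_ge0 ?sqr_ge0 ?(ltW (c_gt0 lN)).
have: 0 <= c i * al i ^+ 2 by rewrite mulr_ge0 ?sqr_ge0 ?(ltW (c_gt0 iN)).
rewrite /energy; lra.
Qed.

Let S_le i : (0 < i <= N)%N -> S i <= 2 * K * al i.
Proof.
move=> iN; rewrite /S /al mulrA ler_pM2r ?invr_gt0 ?c_gt0 //.
have := energy_le iN.
have: 0 <= c i * (mass i / c i) ^+ 2 by rewrite mulr_ge0 ?sqr_ge0 ?(ltW (c_gt0 iN)).
rewrite /al; lra.
Qed.

Let v_ge0 j : (j <= N)%N -> 0 <= v j.
Proof.
move=> jN; rewrite /v big_nat; apply: sumr_ge0 => i /andP[i0 ij].
by apply: S_ge0; rewrite i0 (leq_trans _ jN).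
Qed.

Let v_le j : (j <= N)%N -> v j <= 2 * K * u j.
Proof.
move=> jN; rewrite /v /u mulr_sumr !big_nat; apply: ler_sum => i /andP[i0 ij].
by apply: S_le; rewrite i0 (leq_trans _ jN).
Qed.

Let u_ge0 j : (j <= N)%N -> 0 <= u j.
Proof.
move=> jN; rewrite /u big_nat; apply: sumr_ge0 => i /andP[i0 ij].
by apply: al_ge0; rewrite i0 (leq_trans _ jN).
Qed.

Let Phi (x : R) j := v j + (u j - x) ^+ 2.

Let Phi_ge0 x j : (j <= N)%N -> 0 <= Phi x j.
Proof. by move=> jN; rewrite addr_ge0 ?v_ge0 ?sqr_ge0. Qed.

(* [Phi x j] dominates [E_j (tau - x)^2], tau being the killing time. *)
Let Phi_step x j : (0 < j <= N)%N ->
  (1 - a j - b j) * Phi (x - 1) j + a j * Phi (x - 1) j.-1 + b j * Phi (x - 1) j.+1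
    <= Phi x j.
Proof.
case: j => // j jN; have := drift_u jN; have := drift_v jN; rewrite /=.
have recu k : u k.+1 = u k + al k.+1 by rewrite /u big_nat_recr.
have recv k : v k.+1 = v k + S k.+1 by rewrite /v big_nat_recr.
rewrite /Phi !recu !recv.
move: (a j.+1) (b j.+1) (u j) (v j) (al j.+1) (al j.+2) (S j.+1) (S j.+2).
move=> A B U V x1 x2 s1 s2 e1 e2.
rewrite -subr_ge0.
(* The slack is exactly 1, the squared drift of [u]. *)
suff -> : V + s1 + (U + x1 - x) ^+ 2 -
  ((1 - A - B) * (V + s1 + (U + x1 - (x - 1)) ^+ 2) +
   A * (V + (U - (x - 1)) ^+ 2) +
   B * (V + s1 + s2 + (U + x1 + x2 - (x - 1)) ^+ 2)) = 1 by [].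
transitivity ((A * s1 - B * s2) - (A * x1 ^+ 2 + B * x2 ^+ 2)
  + 2 * (U + x1 - x + 1) * (A * x1 - B * x2) - 2 * (U + x1 - x + 1) + 1); first by ring.
rewrite e1 e2; ring.
Qed.

Variable G : nat -> nat -> R.
Hypothesis G_init : forall j, (0 < j <= N)%N -> G 0 j = 1.
Hypothesis G_kill : forall t, G t 0 = 0.
Hypothesis G_step : forall t j, (0 < j <= N)%N ->
  G t.+1 j = (1 - a j - b j) * G t j + a j * G t j.-1 + b j * G t j.+1.

Lemma killed_concentration j : (j <= N)%N -> exists2 m : R, 0 <= m &
  forall t : nat, (m <= t%:R -> (t%:R - m) ^+ 2 * G t j <= 2 * K * m) /\
    (t%:R <= m -> (m - t%:R) ^+ 2 * (1 - G t j) <= 2 * K * m).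
Proof.
move=> jN; exists (u j); first exact: u_ge0.
have a0 k : (0 < k <= N)%N -> 0 <= a k by move=> kN; exact/ltW/a_gt0.
have stay k : (0 < k <= N)%N -> 0 <= 1 - a k - b k by move=> /ab_le1; lra.
(* Induction on [t] for all [x]: a first step shifts [x] to [x - 1], and [Phi] is a supersolution of
   the recursion for [G]. *)
have below t : forall (x : R) k, x <= t%:R -> (k <= N)%N ->
    (t%:R - x) ^+ 2 * G t k <= Phi x k.
  elim: t => [|t IH] x k xt kN.
    case: k kN => [|k] kN; first by rewrite G_kill mulr0 Phi_ge0.
    rewrite G_init // mulr1 /Phi -[leLHS]add0r lerD ?v_ge0 //.
    have := u_ge0 kN; move: xt; nra.
  case: k kN => [|k] kN; first by rewrite G_kill mulr0 Phi_ge0.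
  rewrite G_step //; refine (le_trans _ (@Phi_step x k.+1 kN)).
  have xt' : x - 1 <= t%:R by rewrite -natr1 in xt; lra.
  have -> : t.+1%:R - x = t%:R - (x - 1) :> R by rewrite -natr1; ring.
  set X := t%:R - (x - 1); set Y := G t k.+1; set Y1 := G t k; set Y2 := G t k.+2.
  have -> : X ^+ 2 * ((1 - a k.+1 - b k.+1) * Y + a k.+1 * Y1 + b k.+1 * Y2) =
    (1 - a k.+1 - b k.+1) * (X ^+ 2 * Y) + a k.+1 * (X ^+ 2 * Y1) +
    b k.+1 * (X ^+ 2 * Y2) by ring.
  apply: lerD; first by apply: lerD; rewrite ler_wpM2l ?stay ?a0 ?IH // ltnW.
  case: (ltngtP k.+1 N) (kN) => // [kN' _|-> _]; last by rewrite bN !mul0r.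
  by rewrite ler_wpM2l ?b_ge0 ?IH.
have above t : forall (x : R) k, t%:R <= x -> (0 < k <= N)%N ->
    (x - t%:R) ^+ 2 * (1 - G t k) <= Phi x k.
  elim: t => [|t IH] x k tx /[dup] kN /andP[k0 kleN].
    by rewrite G_init // subrr mulr0 Phi_ge0.
  have tx' : t%:R <= x - 1 by rewrite -natr1 in tx; lra.
  (* At the killed state [1 - G] is 1 and [Phi (x - 1) 0] is [(x - 1)^2], which suffices since
     [0 <= t <= x - 1]. *)
  have IH' i : (i <= N)%N -> (x - 1 - t%:R) ^+ 2 * (1 - G t i) <= Phi (x - 1) i.
    case: i => [_|i iN]; last exact: IH.
    rewrite G_kill subr0 mulr1 /Phi /u /v !big_geq // add0r.
    have : 0 <= t%:R :> R by []. 
    move: tx'; nra.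
  rewrite G_step //; apply: (le_trans _ (Phi_step x kN)).
  have -> : x - t.+1%:R = x - 1 - t%:R :> R by rewrite -natr1; ring.
  set X := x - 1 - t%:R; set Y := G t k; set Y1 := G t k.-1; set Y2 := G t k.+1.
  have -> : X ^+ 2 * (1 - ((1 - a k - b k) * Y + a k * Y1 + b k * Y2)) =
    (1 - a k - b k) * (X ^+ 2 * (1 - Y)) + a k * (X ^+ 2 * (1 - Y1)) +
    b k * (X ^+ 2 * (1 - Y2)) by ring.
  apply: lerD.
    by apply: lerD; rewrite ler_wpM2l ?stay ?a0 ?IH' // (leq_trans (leq_pred _)).
  case: (ltngtP k N) (kleN) => // [kltN _|-> _]; last by rewrite bN !mul0r.
  by rewrite ler_wpM2l ?b_ge0 ?IH'.
move=> t; split => tm.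
  by rewrite (le_trans (below t _ _ tm jN)) // /Phi subrr expr0n addr0 v_le.
case: j => [|j] in jN tm *.
  move: tm; rewrite /u big_geq // => t0.
  have -> : t%:R = 0 :> R by apply/le_anti; rewrite t0 ler0n.
  by rewrite subrr expr0n mul0r mulr0.
by rewrite (le_trans (above t _ j.+1 tm jN)) // /Phi subrr expr0n addr0 v_le.
Qed.
End KilledBirthDeath.

(** * The dual chain *)

Lemma sum_by_parts (R : pzRingType) (N : nat) (D phi : nat -> R) :
  D 0%N = 0 -> D N.+1 = 0 ->
  \sum_(1 <= j < N.+1) D j * (phi j - phi j.-1) =
  \sum_(0 <= j < N.+1) (D j - D j.+1) * phi j.
Proof.
move=> D0 DN.
under [RHS]eq_bigr do rewrite mulrBl.
rewrite sumrB [X in _ = X - _]big_ltn // D0 mul0r add0r [X in _ - X]big_nat_recr //= DN mul0r addr0.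
under eq_bigr do rewrite mulrBr.
by rewrite sumrB; congr (_ - _); rewrite big_add1.
Qed.

Section DualChain.
Variables (R : realFieldType) (N : nat) (p q w : nat -> R) (K : R).
Hypothesis w_gt0 : forall j, (j <= N)%N -> 0 < w j.
Hypothesis p_gt0 : forall j, (j < N)%N -> 0 < p j.
Hypothesis q_gt0 : forall j, (0 < j <= N)%N -> 0 < q j.
Hypothesis balance : forall j, (j < N)%N -> w j * p j = w j.+1 * q j.+1.
Hypothesis p_half : forall j, (j < N)%N -> p j <= 2^-1.
Hypothesis q_half : forall j, (0 < j <= N)%N -> q j <= 2^-1.
Hypothesis K_gt0 : 0 < K.
Hypothesis poincare : forall phi : nat -> R,
  \sum_(0 <= x < N.+1) w x * phi x = 0 ->
  \sum_(0 <= x < N.+1) w x * phi x ^+ 2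
    <= K * \sum_(1 <= j < N.+1) w j * q j * (phi j - phi j.-1) ^+ 2.

Let h j := \sum_(j <= x < N.+1) w x.

Let hS j : (j <= N)%N -> h j = w j + h j.+1.
Proof. by move=> jN; rewrite /h big_ltn. Qed.

Let h_ge0 j : 0 <= h j.
Proof.
rewrite /h big_nat; apply: sumr_ge0 => x /andP[_ xN].
by apply/ltW/w_gt0.
Qed.

Let h_gt0 j : (j <= N)%N -> 0 < h j.
Proof. by move=> jN; rewrite hS // ltr_pwDl ?w_gt0 ?h_ge0. Qed.

Let Q j := w j * q j.
Let Q_gt0 j : (0 < j <= N)%N -> 0 < Q j.
Proof. by move=> /[dup] jN /andP[_ ?]; rewrite mulr_gt0 ?w_gt0 ?q_gt0. Qed.

(** Let [psi] be the centred potential with gradient [D / Q]. The left side is the pairing of [psi]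
    with the divergence of [D], and the squared norm of [psi] is at most [K] times the left side.
    Cauchy-Schwarz then gives the same constant [K]. *)
Let flow_le (D : nat -> R) : D 0%N = 0 -> D N.+1 = 0 ->
  \sum_(1 <= j < N.+1) D j ^+ 2 / Q j
    <= K * \sum_(0 <= x < N.+1) (D x - D x.+1) ^+ 2 / w x.
Proof.
move=> D0 DN; pose phi j := \sum_(1 <= i < j.+1) D i / Q i.
have phiS j : (0 < j)%N -> phi j - phi j.-1 = D j / Q j.
  by case: j => // j _; rewrite /phi big_nat_recr //= addrAC subrr add0r.
pose m := (\sum_(0 <= x < N.+1) w x * phi x) / h 0%N.
pose psi j := phi j - m.
have psi0 : \sum_(0 <= x < N.+1) w x * psi x = 0.
  under eq_bigr do rewrite mulrBr.
  by rewrite sumrB -mulr_suml -/(h 0%N) /m mulrCA divff ?mulr1 ?subrr // gt_eqF ?h_gt0.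
have psiS j : psi j - psi j.-1 = phi j - phi j.-1 by rewrite /psi; ring.
set X := \sum_(1 <= j < N.+1) _.
have X1 : X = \sum_(0 <= x < N.+1) (D x - D x.+1) * psi x.
  rewrite -sum_by_parts //; apply: eq_big_nat => j /andP[j0 _].
  by rewrite psiS phiS // mulrA expr2.
have X2 : \sum_(0 <= x < N.+1) w x * psi x ^+ 2 <= K * X.
  apply: le_trans (poincare psi0) _; rewrite ler_pM2l //.
  rewrite le_eqVlt; apply/orP; left; apply/eqP; apply: eq_big_nat => j jN.
  rewrite psiS phiS ?(andP jN).1 // -/(Q j).
  have : Q j != 0 by rewrite gt_eqF // Q_gt0.
  by move=> ?; field.
suff : X * K <= (K * (K * \sum_(0 <= x < N.+1) (D x - D x.+1) ^+ 2 / w x) + K * X) / 2.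
  by rewrite -[in X in _ -> X](ler_pM2l K_gt0); lra.
(* AM-GM: [d psi <= K d^2 / (2 w) + w psi^2 / (2 K)] *)
apply: le_trans (_ : (K * (K * \sum_(0 <= x < N.+1) (D x - D x.+1) ^+ 2 / w x) +
   \sum_(0 <= x < N.+1) w x * psi x ^+ 2) / 2 <= _); last by move: X2; lra.
rewrite ler_pdivlMr // X1 !mulr_suml !mulr_sumr -big_split /= !big_nat.
apply: ler_sum => x /andP[_ xN]; have wx := w_gt0 (xN : (x <= N)%N).
rewrite -subr_ge0; set d := D x - _.
have -> : K * (K * (d ^+ 2 / w x)) + w x * psi x ^+ 2 - d * psi x * K * 2 =
  w x * (K * d / w x - psi x) ^+ 2.
  have : w x != 0 by rewrite gt_eqF.
  by move=> ?; field.
by rewrite mulr_ge0 ?sqr_ge0 ?ltW.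
Qed.

(** The Siegmund dual goes down with probability [p j.-1], up with probability [q j], and is
    reversible for [1 / Q]. These are the probabilities and the reversible measure of its Doob
    transform by [h]. *)
Let a j := p j.-1 * h j.-1 / h j.
Let b j := q j * h j.+1 / h j.
Let rho j := h j ^+ 2 / Q j.

(** This is harmonicity of [h] for the dual, a consequence of detailed balance; the transform thus
    keeps the holding probabilities. *)
Let abE j : (0 < j <= N)%N -> a j + b j = p j.-1 + q j.
Proof.
case: j => // j /= jN.
have := balance jN; have := hS (ltnW jN); have := hS jN.
have := h_gt0 jN; rewrite /a /b /= => hj e1 e2 e3.
rewrite -mulrDl; apply: (mulIf (lt0r_neq0 hj)); rewrite divfK ?gt_eqF //.
rewrite e2 mulrDr (mulrC _ (w j)) e3 [in RHS]e1 [in LHS]e1; ring.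
Qed.

Let conductance j : (j < N)%N -> rho j.+1 * a j.+1 = h j * h j.+1 / w j.
Proof.
move=> jN; rewrite /rho /a /Q /= -balance //.
have := h_gt0 jN; have := w_gt0 (ltnW jN); have := p_gt0 jN.
move=> /lt0r_neq0 p0 /lt0r_neq0 w0 /lt0r_neq0 h0.
by field; rewrite p0 w0 h0.
Qed.

Let killed_poincare (f : nat -> R) : f 0%N = 0 ->
  \sum_(1 <= i < N.+1) rho i * f i ^+ 2
    <= K * \sum_(1 <= i < N.+1) rho i * a i * (f i - f i.-1) ^+ 2.
Proof.
move=> f0; pose D j := h j * f j.
have DN : D N.+1 = 0 by rewrite /D /h big_geq ?mul0r.
have D0 : D 0%N = 0 by rewrite /D f0 mulr0.
have := flow_le D0 DN; congr (_ <= K * _).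
  by apply: eq_bigr => j _; rewrite /D /rho exprMn mulrAC.
rewrite [RHS]big_add1 /=.
transitivity (\sum_(0 <= x < N.+1)
    ((D x - D x.+1) ^+ 2 / w x + (D x.+1 * f x.+1 - D x * f x))).
  by rewrite big_split /= telescope_sumr // DN f0 mul0r mulr0 subrr addr0.
(* Ground-state identity: with [h x = w x + h x.+1] the square becomes a weighted squared increment
   of [f], up to a telescoping term. *)
have tele x : (x <= N)%N -> (D x - D x.+1) ^+ 2 / w x + (D x.+1 * f x.+1 - D x * f x) =
    h x * h x.+1 / w x * (f x.+1 - f x) ^+ 2.
  move=> xN; rewrite /D hS //; have := w_gt0 xN; move=> /lt0r_neq0 w0.
  by field.
have hN : h N.+1 = 0 by rewrite /h big_geq.
rewrite big_nat_recr //= tele // hN mulr0 !mul0r addr0.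
by apply: eq_big_nat => x /andP[_ xN]; rewrite tele ?conductance // ltnW.
Qed.

Lemma dual_concentration (D : nat -> nat -> R) :
  (forall j, (0 < j <= N)%N -> D 0 j = h j) ->
  (forall t, D t 0 = 0) -> (forall t, D t N.+1 = 0) ->
  (forall t j, (0 < j <= N)%N ->
    D t.+1 j = D t j + p j.-1 * (D t j.-1 - D t j) + q j * (D t j.+1 - D t j)) ->
  forall j, (j <= N)%N -> exists2 m : R, 0 <= m &
  forall t : nat, (m <= t%:R -> (t%:R - m) ^+ 2 * (D t j / h j) <= 2 * K * m) /\
    (t%:R <= m -> (m - t%:R) ^+ 2 * (1 - D t j / h j) <= 2 * K * m).
Proof.
move=> D_init D_kill D_end D_step j jN.
apply: (@killed_concentration R N a b rho K _ _ _ _ _ _ K_gt0 killed_poincare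
  (fun t j => D t j / h j)) => //.
- case=> // i iN; rewrite /a !mulr_gt0 ?invr_gt0 ?h_gt0 ?p_gt0 //; exact: ltnW.
- move=> i iN; rewrite /b !mulr_ge0 ?invr_ge0 ?h_ge0 //; exact/ltW/q_gt0.
- by rewrite /b /h big_geq // mulr0 mul0r.
- case=> // i iN; rewrite abE //=.
  have := p_half iN; have := @q_half i.+1 iN; lra.
- by move=> i iN; rewrite /rho mulr_gt0 ?invr_gt0 ?Q_gt0 ?exprn_gt0 ?h_gt0 //; case/andP: iN.
- move=> i /andP[i0 iN]; rewrite conductance //.
  have := h_gt0 (ltnW iN); have := w_gt0 (ltnW iN).
  have := @q_gt0 i; rewrite i0 (ltnW iN) => /(_ isT).
  move=> /lt0r_neq0 p0 /lt0r_neq0 w0 /lt0r_neq0 h0.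
  by rewrite /rho /b /Q; field; rewrite p0 w0 h0.
- by move=> i /[dup] iN /andP[i0 iN']; rewrite D_init // divff // gt_eqF ?h_gt0.
- by move=> t; rewrite D_kill mul0r.
- move=> t; case=> // i /= iN.
  have -> : 1 - a i.+1 - b i.+1 = 1 - p i - q i.+1 by rewrite -addrA -opprD abE //= opprD addrA.
  rewrite D_step //= /a /b /=.
  have /lt0r_neq0 h1 := h_gt0 iN; have /lt0r_neq0 h0 := h_gt0 (ltnW iN).
  (* At the top state [h i.+2 = 0], so the quotient there is 0 by convention; [D_end] makes the two
     recursions agree. *)
  case: (ltngtP i.+1 N) (iN) => // [/h_gt0/lt0r_neq0 h2 _|iE _].
    by field; rewrite h2 h1 h0.
  have h2 : h i.+2 = 0 by rewrite iE /h big_geq.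
  by rewrite h2 [in D t i.+2]iE D_end !mulr0 !mul0r; field; rewrite h0 h1.
Qed.
End DualChain.

(** * Tails of distributions under a birth-and-death kernel *)

Lemma inord_eqE n i j : (i <= n)%N -> (j <= n)%N ->
  (inord i == inord j :> 'I_n.+1) = (i == j).
Proof. by move=> ni nj; rewrite -val_eqE /= !inordK. Qed.

Section RowVectors.
Variables (R : realType) (N : nat).
Implicit Types (P : 'M[R]_N.+1) (mu nu : 'rV[R]_N.+1).

Definition tail mu (j : nat) := \sum_(x < N.+1 | (j <= x)%N) mu 0 x.

Lemma tail0 mu : tail mu 0 = \sum_x mu 0 x.
Proof. by rewrite /tail; apply: eq_bigl. Qed.

Lemma tail_out mu j : (N < j)%N -> tail mu j = 0.
Proof.
move=> Nj; rewrite /tail big_pred0 // => x.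
by apply/negbTE; rewrite -ltnNge (leq_trans (ltn_ord x)).
Qed.

Lemma tail_nat mu j : tail mu j = \sum_(j <= x < N.+1) mu 0 (inord x).
Proof.
rewrite /tail (eq_bigr (fun x : 'I_N.+1 => mu 0 (inord x))) => [|x _]; last first.
  by rewrite inord_val.
rewrite -(big_mkord (fun x => (j <= x)%N) (fun x => mu 0 (inord x))).
by rewrite (big_nat_widenl j 0).
Qed.

Lemma tailS mu (x : 'I_N.+1) : tail mu x = mu 0 x + tail mu x.+1.
Proof. by rewrite !tail_nat big_ltn // inord_val. Qed.

Lemma tailB mu nu j : tail (mu - nu) j = tail mu j - tail nu j.
Proof. by rewrite /tail -sumrB; apply: eq_bigr => x _; rewrite !mxE. Qed.

Lemma tail_mul mu P j :
  tail (mu *m P) j = \sum_x mu 0 x * \sum_(y < N.+1 | (j <= y)%N) P x y.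
Proof.
rewrite /tail; under eq_bigr do rewrite mxE.
by rewrite exchange_big /=; apply: eq_bigr => x _; rewrite mulr_sumr.
Qed.

Lemma sum_ord_nat (F : 'I_N.+1 -> R) : \sum_x F x = \sum_(0 <= i < N.+1) F (inord i).
Proof. by rewrite big_mkord; apply: eq_bigr => x _; rewrite inord_val. Qed.

End RowVectors.

Section BirthDeath.
Variables (R : realType) (N : nat) (P : 'M[R]_N.+1) (pi : 'rV[R]_N.+1).
Hypothesis P_bd : birth_death P.
Hypothesis P_lazy : lazy P.
Hypothesis P_irr : irreducible P.
Hypothesis pi_stat : stationary_distribution P pi.

Definition up (x : nat) := P (inord x) (inord x.+1).
Definition down (x : nat) := P (inord x) (inord x.-1).

Let P_ge0 x y : 0 <= P x y. Proof. by case: P_bd => _ [] . Qed.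
Let P_row x : \sum_y P x y = 1. Proof. by case: P_bd => _ []. Qed.
Let P_band (x y : 'I_N.+1) : (x.+1 < y)%N || (y.+1 < x)%N -> P x y = 0.
Proof. by case: P_bd => _ _; apply. Qed.

Lemma tail_kernel (x : 'I_N.+1) j : (0 < j <= N)%N ->
  \sum_(y < N.+1 | (j <= y)%N) P x y =
  (j <= x)%N%:R + (x.+1 == j)%:R * up j.-1 - (x == j :> nat)%:R * down j.
Proof.
move=> /andP[j0 jN]; case: (ltngtP j x) => [jx|xj|jx].
- rewrite gtn_eqF ?ltnS ?(ltnW jx) // !mul0r subr0 addr0.
  rewrite -(P_row x) big_mkcond; apply: eq_bigr => y _; case: leqP => // yj.
  by rewrite P_band // (leq_ltn_trans yj jx) orbT.
- rewrite mul0r subr0 add0r; case: eqP => [xj'|/eqP xj'].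
    rewrite (bigD1 (inord j)) ?inordK //= big1 ?addr0 ?mul1r.
      by rewrite /up -xj' /= inord_val.
    move=> y /andP[jy /eqP yj]; apply: P_band; rewrite xj' ltn_neqAle jy andbT.
    by apply/orP; left; apply/eqP => jy'; apply: yj; rewrite jy' inord_val.
  rewrite mul0r big1 // => y jy; apply: P_band.
  by rewrite (leq_trans _ jy) // ltn_neqAle xj' xj.
- rewrite -jx gtn_eqF // mul0r addr0 mul1r -(P_row x).
  rewrite [X in _ = X - _](bigID (fun y : 'I_N.+1 => (j <= y)%N)) /=.
  rewrite [X in _ = _ + X - _](bigD1 (inord j.-1)) /=; last first.
    by rewrite -ltnNge inordK ?prednK // leqW.
  rewrite [X in _ = _ + (_ + X) - _]big1 ?addr0 => [|y /andP[jy /eqP yj]].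
    by rewrite /down jx inord_val addrK.
  apply: P_band; rewrite -jx; apply/orP; right; rewrite ltn_neqAle ltnNge jy andbT.
  by apply/eqP => yj'; apply: yj; rewrite -yj' /= inord_val.
Qed.

Lemma tail_step (mu : 'rV[R]_N.+1) j : (0 < j <= N)%N ->
  tail (mu *m P) j = tail mu j + mu 0 (inord j.-1) * up j.-1 - mu 0 (inord j) * down j.
Proof.
move=> /[dup] jN /andP[j0 jleN]; rewrite tail_mul.
under eq_bigr do rewrite tail_kernel // mulrBr mulrDr.
rewrite sumrB big_split /=; congr (_ + _ - _).
- by rewrite /tail [RHS]big_mkcond; apply: eq_bigr => x _; case: leqP; rewrite ?mulr1 ?mulr0.
- rewrite (bigD1 (inord j.-1)) //= big1 ?addr0 ?inordK ?prednK ?eqxx ?mul1r //.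
    exact: ltnW.
  move=> x /eqP xj; case: eqP => [xj'|]; last by rewrite mul0r mulr0.
  by case: xj; rewrite -xj' /= inord_val.
- rewrite (bigD1 (inord j)) //= big1 ?addr0 ?inordK ?eqxx ?mul1r //.
  move=> x /eqP xj; case: eqP => [xj'|]; last by rewrite mul0r mulr0.
  by case: xj; rewrite -xj' /= inord_val.
Qed.

Lemma mx_powS t : P ^+ t.+1 = P ^+ t *m P. Proof. by rewrite exprSr. Qed.

Lemma pow_ge0 t x y : 0 <= (P ^+ t) x y.
Proof.
elim: t x y => [|t IH] x y; first by rewrite expr0 mxE ler0n.
by rewrite mx_powS mxE sumr_ge0 // => z _; rewrite mulr_ge0.
Qed.

Lemma pow_row t x : \sum_y (P ^+ t) x y = 1.
Proof.
elim: t => [|t IH].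
  rewrite expr0 (bigD1 x) //= mxE eqxx big1 ?addr0 // => y yx.
  by rewrite mxE eq_sym (negbTE yx).
rewrite mx_powS; under eq_bigr do rewrite mxE.
rewrite exchange_big /= -{}IH; apply: eq_bigr => y _.
by rewrite -mulr_sumr P_row mulr1.
Qed.

Lemma stationary_pow t : pi *m P ^+ t = pi.
Proof.
elim: t => [|t IH]; first by rewrite expr0 mulmx1.
by rewrite mx_powS mulmxA IH; case: pi_stat.
Qed.

Lemma stationary_gt0 x : 0 < pi 0 x.
Proof.
have [pi0 pi1 _] := pi_stat.
have [y py] : exists y, 0 < pi 0 y.
  apply/existsP/contraT; rewrite negb_exists => /forallP pn.
  suff : \sum_y pi 0 y = 0 by rewrite pi1 => /eqP; rewrite oner_eq0.
  by apply: big1 => y _; apply/le_anti; rewrite pi0 andbT leNgt.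
have [t tP] := P_irr y x.
rewrite -(stationary_pow t) mxE (bigD1 y) //= ltr_pwDl ?mulr_gt0 //.
by apply: sumr_ge0 => z _; rewrite mulr_ge0 ?pow_ge0.
Qed.

(** A step leaves the stationary mass above [j] unchanged, so the flows across the edge from [j] to
    [j.+1] cancel. *)
Lemma detailed_balance j : (j < N)%N ->
  pi 0 (inord j) * up j = pi 0 (inord j.+1) * down j.+1.
Proof.
move=> jN; have [_ _ e] := pi_stat.
by have := @tail_step pi j.+1 jN; rewrite e /=; lra.
Qed.

Lemma up_gt0 j : (j < N)%N -> 0 < up j.
Proof.
move=> jN; rewrite lt0r P_ge0 andbT; apply/eqP => up0.
(* If [up j] vanishes, the chain started at 0 never gets above [j]. *)
have H t : tail (row 0 (P ^+ t)) j.+1 = 0.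
  apply/le_anti/andP; split; last first.
    by apply: sumr_ge0 => x _; rewrite mxE pow_ge0.
  elim: t => [|t IH].
    rewrite expr0 /tail big1 // => x jx; rewrite !mxE.
    by case: eqP jx => // <-.
  rewrite mx_powS row_mul tail_step //= up0 mulr0 addr0.
  rewrite (le_trans _ IH) // lerBlDr lerDl; apply: mulr_ge0; last exact: P_ge0.
  by rewrite mxE pow_ge0.
have [t] := P_irr 0 (inord N).
rewrite ltNge => /negP; apply.
rewrite -(H t) /tail (bigD1 (inord N)) /=; last by rewrite inordK.
by rewrite mxE lerDl; apply: sumr_ge0 => x _; rewrite mxE pow_ge0.
Qed.

Lemma down_gt0 j : (0 < j <= N)%N -> 0 < down j.
Proof.
case: j => // j jN.
have : 0 < pi 0 (inord j.+1) * down j.+1.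
  by rewrite -detailed_balance // mulr_gt0 ?stationary_gt0 ?up_gt0.
by rewrite pmulr_rgt0 ?stationary_gt0.
Qed.

Lemma offdiag_half x y : x != y -> P x y <= 2^-1.
Proof.
move=> xy; have := P_row x; rewrite (bigD1 x) //= (bigD1 y) 1?eq_sym //=.
have := P_lazy x; set S := \sum_(i < N.+1 | _) _.
have : 0 <= S by apply: sumr_ge0.
by lra.
Qed.

Lemma up_half j : (j < N)%N -> up j <= 2^-1.
Proof. by move=> jN; apply: offdiag_half; rewrite inord_eqE ?ltn_eqF // ltnW. Qed.

Lemma down_half j : (0 < j <= N)%N -> down j <= 2^-1.
Proof.
by case: j => // j /= jN; apply: offdiag_half; rewrite inord_eqE ?gtn_eqF // ltnW.
Qed.

(** [D j] is the net outflow of [mu] from the states [>= j] in one step. Summation by parts against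
    [f] and detailed balance turn it into a sum over edges. *)
Lemma dirichlet_form (f : 'I_N.+1 -> R) :
  \sum_x pi 0 x * f x ^+ 2 - \sum_x pi 0 x * f x * (\sum_y P x y * f y) =
  \sum_(1 <= j < N.+1) pi 0 (inord j) * down j * (f (inord j) - f (inord j.-1)) ^+ 2.
Proof.
pose mu := \row_x (pi 0 x * f x).
pose D j := tail mu j - tail (mu *m P) j.
have D0 : D 0%N = 0.
  rewrite /D !tail0; apply/eqP; rewrite subr_eq0; apply/eqP.
  under [RHS]eq_bigr do rewrite mxE.
  rewrite exchange_big /=; apply: eq_bigr => x _.
  by rewrite -mulr_sumr P_row mulr1.
have DN : D N.+1 = 0 by rewrite /D !tail_out // subr0.
transitivity (\sum_(0 <= j < N.+1) (D j - D j.+1) * f (inord j)).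
  transitivity (\sum_x (mu 0 x - (mu *m P) 0 x) * f x).
    under [RHS]eq_bigr do rewrite mulrBl.
    rewrite sumrB; congr (_ - _); first by apply: eq_bigr => x _; rewrite mxE expr2 mulrA.
    under [RHS]eq_bigr do rewrite mxE mulr_suml.
    rewrite exchange_big /=; apply: eq_bigr => x _; rewrite mulr_sumr.
    by apply: eq_bigr => y _; rewrite mxE mulrA.
  rewrite sum_ord_nat; apply: eq_big_nat => j /andP[_ jN]; congr (_ * _).
  have := tailS mu (inord j); have := tailS (mu *m P) (inord j); rewrite !inordK //.
  by rewrite /D; lra.
rewrite -(sum_by_parts (D := D)) //; apply: eq_big_nat => j /andP[j0 jN].
rewrite /D tail_step ?j0 // !mxE.
case: j j0 jN => // j _ jN /=; have := detailed_balance jN.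
move: (up j) (down j.+1) (pi _ _) (pi _ _) (f _) (f _) => u d p1 p2 f1 f2 e.
transitivity ((f1 - f2) * (p1 * d * f1 - p2 * u * f2)); first by ring.
rewrite e; ring.
Qed.

End BirthDeath.

(** * Total positivity and total variation *)

Section LikelihoodRatio.
Variables (R : realType) (N : nat).
Implicit Types (mu nu : 'rV[R]_N.+1) (A B : 'M[R]_N.+1).

Definition prob_row mu := (forall x, 0 <= mu 0 x) /\ \sum_x mu 0 x = 1.

(* The likelihood ratio [nu / mu] is nondecreasing. *)
Definition lr_le mu nu :=
  forall z w : 'I_N.+1, (z < w)%N -> mu 0 w * nu 0 z <= mu 0 z * nu 0 w.

Definition tp2 A := forall x y : 'I_N.+1, (x < y)%N -> lr_le (row x A) (row y A).

(* Cauchy-Binet for 2 x 2 minors, symmetrized over the pair of inner indices. *)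
Lemma tp2_mul A B : tp2 A -> tp2 B -> tp2 (A *m B).
Proof.
move=> tA tB x y xy z w zw; rewrite -subr_ge0.
pose F i k := A x i * A y k * (B i z * B k w - B i w * B k z).
have E : row x (A *m B) 0 z * row y (A *m B) 0 w - row x (A *m B) 0 w * row y (A *m B) 0 z
   = \sum_i \sum_k F i k.
  rewrite !mxE !big_distrlr /= -sumrB; apply: eq_bigr => i _.
  by rewrite -sumrB; apply: eq_bigr => k _; rewrite /F; ring.
suff : 0 <= \sum_i \sum_k F i k + \sum_i \sum_k F i k by rewrite E; lra.
rewrite {2}exchange_big -big_split /=; apply: sumr_ge0 => i _.
rewrite -big_split /=; apply: sumr_ge0 => k _.
have -> : F i k + F k i = (A x i * A y k - A x k * A y i) * (B i z * B k w - B i w * B k z).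
  by rewrite /F; ring.
case: (ltngtP i k) => [ik|ki|/val_inj ->].
- have := tA x y xy i k ik; have := tB i k ik z w zw.
  by rewrite !mxE => ? ?; apply: mulr_ge0; lra.
- have := tA x y xy k i ki; have := tB k i ki z w zw.
  by rewrite !mxE => ? ?; apply: mulr_le0; lra.
- by rewrite (_ : _ - _ = 0) ?mul0r // subrr.
Qed.

(** Let [k] be the first state where [nu] exceeds [mu], or [N.+1] if there is none; the monotone
    ratio keeps [nu] above from there on. *)
Lemma lr_crossing mu nu : lr_le mu nu ->
  (forall x, 0 <= mu 0 x) -> (forall x, 0 <= nu 0 x) ->
  exists k : nat, (forall x : 'I_N.+1, (x < k)%N -> nu 0 x <= mu 0 x) /\
                  (forall x : 'I_N.+1, (k <= x)%N -> mu 0 x <= nu 0 x).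
Proof.
move=> mn mu0 nu0.
have [/existsP[x0 x0P]|/existsPn none] := boolP [exists x, mu 0 x < nu 0 x]; last first.
  exists N.+1; split=> x; first by move=> _; rewrite leNgt.
  by rewrite leqNgt ltn_ord.
case: (@arg_minnP _ x0 (fun x => mu 0 x < nu 0 x) (fun x => x : nat) x0P) => k kP kmin.
exists k; split=> x xk.
  by rewrite leNgt; apply/negP => /kmin; rewrite leqNgt xk.
case: (ltngtP k x) xk => // [kx _|/val_inj <- _]; last exact/ltW.
have nk : 0 < nu 0 k := le_lt_trans (mu0 k) kP.
rewrite -(ler_pM2r nk) (le_trans (mn _ _ kx)) // mulrC; apply: ler_wpM2l => //; exact: ltW.
Qed.

Lemma head_tail mu nu k : prob_row mu -> prob_row nu ->
  tail nu k - tail mu k = \sum_(x < N.+1 | ~~ (k <= x)%N) (mu 0 x - nu 0 x).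
Proof.
move=> [_ m1] [_ n1]; rewrite sumrB /tail.
have := m1; have := n1.
rewrite (bigID (fun x : 'I_N.+1 => (k <= x)%N)) /= => e1.
rewrite (bigID (fun x : 'I_N.+1 => (k <= x)%N)) /= => e2.
by lra.
Qed.

(** If [k] is past the crossing point the tails compare termwise, otherwise the complementary heads
    do. *)
Lemma lr_tail mu nu k : prob_row mu -> prob_row nu -> lr_le mu nu -> tail mu k <= tail nu k.
Proof.
move=> pm pn mn; have [c [lo hi]] := lr_crossing mn pm.1 pn.1.
case: (leqP c k) => ck.
  by apply: ler_sum => x kx; apply: hi; apply: leq_trans kx.
rewrite -subr_ge0 head_tail //; apply: sumr_ge0 => x xk.
by rewrite subr_ge0 lo // (leq_trans _ ck) // ltnW // ltnS ltnNge.
Qed.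

Lemma tail_le_tv mu nu k : prob_row mu -> prob_row nu -> tail nu k - tail mu k <= tv_dist mu nu.
Proof.
move=> pm pn; rewrite /tv_dist (bigID (fun x : 'I_N.+1 => (k <= x)%N)) /=.
have e1 : tail nu k - tail mu k <= \sum_(x < N.+1 | ~~ (k <= x)%N) `|mu 0 x - nu 0 x|.
  by rewrite head_tail //; apply: ler_sum => x _; apply: ler_norm.
have e2 : tail nu k - tail mu k <= \sum_(x < N.+1 | (k <= x)%N) `|mu 0 x - nu 0 x|.
  by rewrite -sumrB; apply: ler_sum => x _; rewrite distrC ler_norm.
by move: e1 e2; lra.
Qed.

(** The set where [nu] dominates is a half-line, and total variation is attained on it. *)
Lemma tv_lr mu nu : prob_row mu -> prob_row nu -> lr_le mu nu ->
  exists k, tv_dist mu nu = tail nu k - tail mu k.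
Proof.
move=> pm pn mn; have [c [lo hi]] := lr_crossing mn pm.1 pn.1.
exists c; rewrite /tv_dist (bigID (fun x : 'I_N.+1 => (c <= x)%N)) /=.
have -> : \sum_(x < N.+1 | (c <= x)%N) `|mu 0 x - nu 0 x| = tail nu c - tail mu c.
  by rewrite -sumrB; apply: eq_bigr => x cx; rewrite distrC ger0_norm // subr_ge0 hi.
have -> : \sum_(x < N.+1 | ~~ (c <= x)%N) `|mu 0 x - nu 0 x| = tail nu c - tail mu c.
  rewrite head_tail //; apply: eq_bigr => x cx.
  by rewrite ger0_norm // subr_ge0 lo // ltnNge.
by lra.
Qed.

Lemma tv_sym mu nu : tv_dist mu nu = tv_dist nu mu.
Proof. by congr (_ * _); apply: eq_bigr => x _; rewrite distrC. Qed.

Lemma tv_refl mu : tv_dist mu mu = 0.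
Proof. by rewrite /tv_dist big1 ?mulr0 // => x _; rewrite subrr normr0. Qed.

Lemma tv_triangle mu nu xi : tv_dist mu xi <= tv_dist mu nu + tv_dist nu xi.
Proof.
rewrite /tv_dist -mulrDr ler_pM2l ?invr_gt0 // -big_split /=; apply: ler_sum => x _.
exact: ler_distD.
Qed.

End LikelihoodRatio.

(** * Monotonicity in the starting state and reduction of the distance to tails *)

Section Mixing.
Variables (R : realType) (N : nat) (P : 'M[R]_N.+1) (pi : 'rV[R]_N.+1).
Hypothesis P_bd : birth_death P.
Hypothesis P_lazy : lazy P.
Hypothesis P_irr : irreducible P.
Hypothesis pi_stat : stationary_distribution P pi.

Let P_ge0 x y : 0 <= P x y. Proof. by case: P_bd => _ [] . Qed.
Let P_row x : \sum_y P x y = 1. Proof. by case: P_bd => _ []. Qed.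

Lemma prob_pow t x : prob_row (row x (P ^+ t)).
Proof.
split=> [y|]; first by rewrite mxE pow_ge0.
by under eq_bigr do rewrite mxE; rewrite pow_row.
Qed.

Lemma prob_stationary : prob_row pi.
Proof. by case: pi_stat. Qed.

(** For one step the only minors with a nonzero subtracted product sit on two neighbouring states;
    by laziness that product is at most 1/4 and the diagonal one at least 1/4. *)
Lemma tp2_pow t : tp2 (P ^+ t).
Proof.
elim: t => [|t IH].
  move=> x y xy z w zw; rewrite expr0 !mxE -!natrM ler_nat.
  case: (eqVneq x w) => [xw|]; last by rewrite mul0n.
  case: (eqVneq y z) => [yz|]; last by rewrite muln0.
  by subst; move: xy zw; lia.
rewrite mx_powS; apply: tp2_mul => // x y xy z w zw; rewrite !mxE.
have P0 := fun i j => @P_ge0 i j.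
have [xw|xw] := boolP ((x.+1 < w)%N || (w.+1 < x)%N).
  by case: P_bd => _ _ /(_ _ _ xw) ->; rewrite mul0r mulr_ge0.
have [yz|yz] := boolP ((y.+1 < z)%N || (z.+1 < y)%N).
  by case: P_bd => _ _ /(_ _ _ yz) ->; rewrite mulr0 mulr_ge0.
have zx : z = x by apply: val_inj => /=; move: xy zw xw yz; lia.
have wy : w = y by apply: val_inj => /=; move: xy zw xw yz; lia.
subst z w.
have xney : x != y by rewrite -val_eqE /= ltn_eqF.
have h1 := offdiag_half P_bd P_lazy xney.
have h2 : P y x <= 2^-1 by apply: offdiag_half; rewrite // eq_sym.
apply: (@le_trans _ _ (2^-1 * 2^-1)); first exact: ler_pM.
by apply: ler_pM => //; rewrite invr_ge0.
Qed.

Lemma tail_pow_mono t k (x y : 'I_N.+1) : (x <= y)%N ->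
  tail (row x (P ^+ t)) k <= tail (row y (P ^+ t)) k.
Proof.
case: ltngtP => // [xy _|/val_inj -> //].
by apply: lr_tail; [exact: prob_pow|exact: prob_pow|exact: tp2_pow].
Qed.

Lemma tail_stationary t k : tail pi k = \sum_x pi 0 x * tail (row x (P ^+ t)) k.
Proof.
rewrite -{1}(stationary_pow pi_stat t) tail_mul; apply: eq_bigr => x _; congr (_ * _).
by apply: eq_bigr => y _; rewrite mxE.
Qed.

Lemma tail_0_stationary t k : tail (row 0 (P ^+ t)) k <= tail pi k.
Proof.
have [p0 p1] := prob_stationary.
rewrite (tail_stationary t) -[leLHS]mul1r -p1 mulr_suml; apply: ler_sum => x _.
by rewrite ler_wpM2l // tail_pow_mono.
Qed.

Lemma dist_ge_tv t x : tv_dist (row x (P ^+ t)) pi <= dist_to_stationarity P pi t.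
Proof. exact: (le_bigmax _ (fun x => tv_dist (row x (P ^+ t)) pi)). Qed.

Lemma dist_ge_tail t x k :
  tail pi k - tail (row x (P ^+ t)) k <= dist_to_stationarity P pi t.
Proof.
apply: le_trans (dist_ge_tv t x); apply: tail_le_tv; first exact: prob_pow.
exact: prob_stationary.
Qed.

(** The distance between two starts is attained on a half-line, hence is at most the tail gap
    between the extreme starts, which splits at [tail pi k]. Averaging one start over [pi] gives the
    stationary law. *)
Lemma dist_le_tails t (A B : R) :
  (forall k, tail pi k - tail (row 0 (P ^+ t)) k <= A) ->
  (forall k, tail (row ord_max (P ^+ t)) k - tail pi k <= B) ->
  dist_to_stationarity P pi t <= A + B.
Proof.
move=> HA HB; have [p0 p1] := prob_stationary.
have A0 : 0 <= A by apply: le_trans (HA N.+1); rewrite !tail_out // subrr.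
have B0 : 0 <= B by apply: le_trans (HB N.+1); rewrite !tail_out // subrr.
have H x y : tv_dist (row x (P ^+ t)) (row y (P ^+ t)) <= A + B.
  wlog xy : x y / (x <= y)%N.
    by move=> W; case: (leqP x y) => [/W //|/ltnW/W]; rewrite tv_sym.
  case: (ltngtP x y) xy => // [xy _|/val_inj -> _]; last by rewrite tv_refl addr_ge0.
  have [k ->] := tv_lr (prob_pow t x) (prob_pow t y) (@tp2_pow t x y xy).
  have := @tail_pow_mono t k 0 x (leq0n _).
  have := @tail_pow_mono t k y ord_max (leq_ord _).
  have := HA k; have := HB k; lra.
apply: bigmax_le => [|x _]; first exact: addr_ge0.
apply: (@le_trans _ _ (\sum_y pi 0 y * tv_dist (row x (P ^+ t)) (row y (P ^+ t)))).
  rewrite /tv_dist; under [leRHS]eq_bigr do rewrite mulrCA.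
  rewrite -mulr_sumr ler_pM2l ?invr_gt0 //.
  under [leRHS]eq_bigr do rewrite mulr_sumr.
  rewrite exchange_big /=; apply: ler_sum => z _.
  rewrite -{1}(stationary_pow pi_stat t) -{1}[row x _ 0 z]mul1r -{1}p1 mulr_suml !mxE -sumrB.
  apply: le_trans (ler_norm_sum _ _ _) _; apply: ler_sum => y _.
  by rewrite -mulrBr normrM (ger0_norm (p0 y)) !mxE.
rewrite -[leRHS]mul1r -p1 mulr_suml; apply: ler_sum => y _.
by rewrite ler_wpM2l.
Qed.

End Mixing.

(** * Spectral gap *)

Section Spectrum.
Local Open Scope complex_scope.
Local Open Scope sesquilinear_scope.
Variables (R : realType) (N : nat) (P : 'M[R]_N.+1) (pi : 'rV[R]_N.+1).
Hypothesis P_bd : birth_death P.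
Hypothesis P_lazy : lazy P.
Hypothesis P_irr : irreducible P.
Hypothesis pi_stat : stationary_distribution P pi.

Let P_ge0 x y : 0 <= P x y. Proof. by case: P_bd => _ [] . Qed.
Let P_row x : \sum_y P x y = 1. Proof. by case: P_bd => _ []. Qed.
Let PC := map_mx (real_complex R) P.

Lemma norm_normc (z : R[i]) : `|z| = (Normc.normc z)%:C.
Proof. by rewrite normc_def; case: z. Qed.

Lemma norm_real (x : R) : `|x%:C| = (`|x|)%:C :> R[i].
Proof. by rewrite normc_def /= expr0n /= addr0 sqrtr_sqr. Qed.

Lemma normc_ge0 (z : R[i]) : 0 <= Normc.normc z.
Proof. by case: z => a b; rewrite sqrtr_ge0. Qed.

(* Apply the triangle inequality in l1 norm to a left eigenvector. *)
Lemma eigenvalue_le_row_norm (M : 'M[R]_N.+1) (z : R[i]) (v : 'rV[R[i]]_N.+1) (c : R) :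
  v *m map_mx (real_complex R) M = z *: v -> v != 0 ->
  (forall x, \sum_y `|M x y| <= c) -> Normc.normc z <= c.
Proof.
move=> vM v0 Mc.
have S0 : 0 < \sum_x `|v 0 x|.
  have [x vx] : exists x, v 0 x != 0.
    apply/existsP; apply: contraNT v0; rewrite negb_exists => /forallP v0.
    by apply/eqP/rowP => x; rewrite mxE; apply/eqP; rewrite -[_ == _]negbK v0.
  by rewrite (bigD1 x) //= ltr_pwDl ?normr_gt0 ?sumr_ge0.
rewrite -lecR -norm_normc -(ler_pM2r S0).
rewrite mulr_sumr; under eq_bigr => x _ do rewrite -normrM.
have -> : \sum_x `|z * v 0 x| = \sum_x `|\sum_y v 0 y * (M y x)%:C|.
  apply: eq_bigr => x _; move/rowP/(_ x): vM; rewrite !mxE => <-; congr (`|_|).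
  by apply: eq_bigr => y _; rewrite mxE.
apply: le_trans (_ : \sum_x \sum_y `|v 0 y| * (`|M y x|)%:C <= _).
  apply: ler_sum => x _; apply: le_trans (ler_norm_sum _ _ _) _; apply: ler_sum => y _.
  by rewrite normrM norm_real.
rewrite exchange_big mulr_sumr /=; apply: ler_sum => y _.
by rewrite -mulr_sumr mulrC ler_wpM2r // -rmorph_sum lecR.
Qed.

Lemma nontrivial_eigenvalue_lt1 z : nontrivial_eigenvalue P z -> Normc.normc z < 1.
Proof.
move=> /andP[/eigenvalueP[v vP v0] z1].
have vM : v *m map_mx (real_complex R) (P + P - 1) = (z + z - 1) *: v.
  by rewrite map_mxB map_mxD map_mx1 mulmxBr mulmx1 mulmxDr vP scalerBl scale1r scalerDl.
(* The matrix [P + P - 1] is stochastic, so [z] lies in the disc of diameter [0, 1]. *)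
have := eigenvalue_le_row_norm vM v0 (c := 1).
have H x : \sum_y `|(P + P - 1) x y| <= 1.
  have E y : `|(P + P - 1) x y| = P x y + P x y - (x == y)%:R.
    rewrite !mxE ger0_norm //; case: eqP => [<-|_] /=; last by rewrite subr0 addr_ge0.
    by rewrite subr_ge0; have := P_lazy x; lra.
  under eq_bigr do rewrite E.
  rewrite sumrB big_split /= P_row (bigD1 x) //= eqxx big1 ?addr0 => [|y]; last first.
    by rewrite eq_sym => /negbTE ->.
  by rewrite addrK.
move=> /(_ H); case: z z1 {vP vM} => a b z1.
rewrite /Normc.normc /= -[X in _ <= X -> _]sqrtr1 -[X in _ -> _ < X]sqrtr1.
rewrite ler_sqrt // ltr_sqrt // => h; rewrite ltNge; apply/negP => h'.
have a1 : a = 1 by nra.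
have b0 : b = 0 by nra.
by move: z1; rewrite a1 b0 => /eqP; apply.
Qed.

(** A left eigenvector for [z != 1] has zero sum, so the matrix with all rows [pi] annihilates it.
    Thus [z ^+ t] is an eigenvalue of [P ^+ t] minus that matrix, whose rows have l1 norm at most
    twice the distance. *)
Lemma eigenvalue_le_dist z t : nontrivial_eigenvalue P z ->
  Normc.normc z ^+ t <= 2 * dist_to_stationarity P pi t.
Proof.
move=> /andP[/eigenvalueP[v vP v0] z1].
have S0 : \sum_x v 0 x = 0.
  apply: (mulfI (_ : z - 1 != 0)); first by rewrite subr_eq0.
  rewrite mulr0 mulrBl mul1r; apply/eqP; rewrite subr_eq0; apply/eqP.
  transitivity (\sum_y (v *m map_mx (real_complex R) P) 0 y).
    by rewrite vP mulr_sumr; apply: eq_bigr => y _; rewrite mxE.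
  under eq_bigr do rewrite mxE.
  rewrite exchange_big /=; apply: eq_bigr => x _.
  under eq_bigr do rewrite mxE.
  by rewrite -mulr_sumr -rmorph_sum P_row mulr1.
have vPt : v *m map_mx (real_complex R) (P ^+ t) = z ^+ t *: v.
  elim: t => [|t IH]; first by rewrite !expr0 map_mx1 mulmx1 scale1r.
  by rewrite mx_powS map_mxM mulmxA IH -scalemxAl vP scalerA -exprSr.
have vM : v *m map_mx (real_complex R) (P ^+ t - \matrix_(x, y) pi 0 y) = z ^+ t *: v.
  rewrite map_mxB mulmxBr vPt; apply/rowP => y; rewrite !mxE.
  under eq_bigr do rewrite !mxE.
  by rewrite -mulr_suml S0 mul0r subr0.
have -> : Normc.normc z ^+ t = Normc.normc (z ^+ t).
  elim: t {vPt vM} => [|t IH]; first by rewrite !expr0 Normc.normc1.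
  by rewrite !exprS IH Normc.normcM.
apply: (eigenvalue_le_row_norm vM v0) => x.
apply: le_trans (_ : 2 * tv_dist (row x (P ^+ t)) pi <= _).
  rewrite /tv_dist mulrA divff ?pnatr_eq0 // mul1r.
  by apply: ler_sum => y _; rewrite !mxE.
by rewrite ler_pM2l // dist_ge_tv.
Qed.

Lemma eigenvalue_set_finite :
  exists s : seq R[i], forall z, nontrivial_eigenvalue P z -> z \in s.
Proof.
have [r rE] := closed_field_poly_normal (char_poly PC).
exists r => z /andP[]; rewrite eigenvalue_root_char -/PC rE rootZ ?root_prod_XsubC //.
by rewrite lead_coef_eq0 monic_neq0 // char_poly_monic.
Qed.

Lemma nontrivial_le_gap z : nontrivial_eigenvalue P z -> Normc.normc z <= 1 - gap P.
Proof.
move=> zP; rewrite /gap opprB addrC subrK; apply: ub_le_sup; last by exists z.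
by exists 1 => _ [w wP <-]; apply/ltW/nontrivial_eigenvalue_lt1.
Qed.

Lemma one_sub_gap_le (c : R) : 0 <= c ->
  (forall z, nontrivial_eigenvalue P z -> Normc.normc z <= c) ->
  1 - gap P <= c.
Proof.
move=> c0 H; rewrite /gap opprB addrC subrK.
set S := (X in sup X); have [->|/set0P S0] := eqVneq S set0; first by rewrite sup0.
by apply: ge_sup => // _ [z zP <-]; apply: H.
Qed.

Lemma gap_le1 : gap P <= 1.
Proof.
suff : 0 <= 1 - gap P by lra.
rewrite /gap opprB addrC subrK; set S := (X in sup X).
have [->|/set0P[_ [z zP _]]] := eqVneq S set0; first by rewrite sup0.
apply: le_trans (normc_ge0 z) _; apply: ub_le_sup; last by exists z.
by exists 1 => _ [w wP <-]; apply/ltW/nontrivial_eigenvalue_lt1.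
Qed.


(** The first case also covers an empty set of nontrivial eigenvalues, for which [sup] is 0. *)
Lemma gap_attained :
  1 - gap P = 0 \/ exists2 z, nontrivial_eigenvalue P z & 1 - gap P = Normc.normc z.
Proof.
have [s sP] := eigenvalue_set_finite.
pose M := \big[Num.max/0]_(z <- s | nontrivial_eigenvalue P z) Normc.normc z.
have M0 : 0 <= M.
  by rewrite /M; elim/big_ind: _ => [//|x y x0 y0|z _]; [rewrite le_max x0|exact: normc_ge0].
have gM : 1 - gap P <= M.
  apply: one_sub_gap_le => // z zP.
  by rewrite /M; apply: le_bigmax_seq; [exact: sP|].
have : M = 0 \/ exists2 z, nontrivial_eigenvalue P z & M = Normc.normc z.
  rewrite /M; elim/big_ind: _ => [|x y|z zP]; [by left| |by right; exists z].
  by case: (leP x y).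
case=> [M_0|[z zP Mz]]; [left|right; exists z => //]; apply/le_anti.
  by rewrite -{1}M_0 gM subr_ge0 gap_le1.
by rewrite -{1}Mz gM nontrivial_le_gap.
Qed.

Lemma gap_gt0 : 0 < gap P.
Proof.
case: gap_attained => [|[z /nontrivial_eigenvalue_lt1]]; first by lra.
by move=> z1 e; rewrite -e in z1; lra.
Qed.

(** An invariant [mu] has no net flow across an edge, so it obeys the same two-term recursion as
    [pi]. This is simplicity of the eigenvalue 1. *)
Lemma left_fixed_proportional (mu : 'rV[R]_N.+1) : mu *m P = mu ->
  exists c, forall x, mu 0 x = c * pi 0 x.
Proof.
move=> muP; exists (mu 0 0 / pi 0 0) => x.
have pi0 y : pi 0 y != 0 by apply/lt0r_neq0/(stationary_gt0 P_bd P_irr pi_stat).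
suff H j : (j <= N)%N -> mu 0 (inord j) = mu 0 0 / pi 0 0 * pi 0 (inord j).
  by have := H x (leq_ord x); rewrite inord_val.
elim: j => [_|j IH jN].
  by rewrite (_ : inord 0 = 0 :> 'I_N.+1) ?divfK //; apply: val_inj; rewrite /= inordK.
have := tail_step P_bd mu (j := j.+1) jN; rewrite muP /= (IH (ltnW jN)) => e.
have d0 := down_gt0 P_bd P_irr pi_stat (j := j.+1) jN.
apply: (mulIf (lt0r_neq0 d0)); move: e (detailed_balance P_bd pi_stat jN).
by set k := _ / _ => e db; rewrite -(mulrA k) -db; lra.
Qed.

Lemma reversible x y : pi 0 x * P x y = pi 0 y * P y x.
Proof.
wlog xy : x y / (x < y)%N.
  by move=> W; case: (ltngtP x y) => [/W //|/W //|/val_inj ->].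
have [xy1|xy1] := boolP (x.+1 < y)%N.
  case: P_bd => _ _ band; rewrite !band ?xy1 ?orbT //; last by rewrite !mulr0.
have xyE : y = x.+1 :> nat by move: xy xy1; lia.
have := detailed_balance P_bd pi_stat (j := x); rewrite /up /down /= -xyE !inord_val.
by apply; move: (ltn_ord y); rewrite xyE.
Qed.

Let s x := Num.sqrt (pi 0 x).
Let s_gt0 x : 0 < s x.
Proof. by rewrite sqrtr_gt0 (stationary_gt0 P_bd P_irr pi_stat). Qed.
Let s_sqr x : s x ^+ 2 = pi 0 x.
Proof. by rewrite sqr_sqrtr // ltW // (stationary_gt0 P_bd P_irr pi_stat). Qed.

(** Conjugating [P] by the square roots of [pi] makes it symmetric by reversibility, so the spectral
    theorem applies. *)
Let A : 'M[R[i]]_N.+1 := \matrix_(x, y) (s x * P x y / s y)%:C.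

Let A_sym x y : A x y = A y x.
Proof.
rewrite !mxE; congr (_%:C).
have /lt0r_neq0 sx := s_gt0 x; have /lt0r_neq0 sy := s_gt0 y.
have -> : s x * P x y / s y = s x ^+ 2 * P x y / (s x * s y) by field; rewrite sx sy.
by rewrite s_sqr reversible -s_sqr; field; rewrite sx sy.
Qed.

Let A_adj : A^t* = A.
Proof.
apply/matrixP => x y; rewrite mxE mxE A_sym mxE.
by apply/CrealP; rewrite complex_real.
Qed.

(** Weighting by [s] turns L2 of [pi] into the Euclidean space and [P] into [A]; in an orthonormal
    eigenbasis of [A] the bound is checked coordinate by coordinate. *)
Lemma l2_contraction_step (f : 'I_N.+1 -> R) : \sum_x pi 0 x * f x = 0 ->
  \sum_x pi 0 x * (\sum_y P x y * f y) ^+ 2 <= (1 - gap P) ^+ 2 * \sum_x pi 0 x * f x ^+ 2.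
Proof.
move=> f0.
have /orthomx_spectralP : A \is normalmx by apply/normalmxP; rewrite A_adj.
set U := spectralmx A; set d := spectral_diag A => AE.
have UU : U \is unitarymx := spectral_unitarymx A.
have UA i y : \sum_x U i x * A x y = d 0 i * U i y.
  have : U *m A = diag_mx d *m U by rewrite {1}AE !mulmxA mulmxV ?mul1mx // spectral_unit.
  move/matrixP/(_ i y); rewrite mxE => ->.
  by rewrite mul_diag_mx mxE.
pose phi : 'rV[R[i]]_N.+1 := \row_x (s x * f x)%:C.
pose c := phi *m U^t*.
have dc i : `|c 0 i * d 0 i| <= (1 - gap P)%:C * `|c 0 i|.
  (* Weighting an eigenvector row of [A] by [s] gives a left eigenvector of [P]. *)
  pose v : 'rV[R[i]]_N.+1 := \row_x (U i x * (s x)%:C).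
  have vP : v *m PC = d 0 i *: v.
    apply/rowP => y; rewrite mxE [RHS]mxE.
    rewrite [v 0 y]mxE mulrA -UA mulr_suml; apply: eq_bigr => x _.
    rewrite !mxE -!mulrA; congr (_ * _); rewrite -!rmorphM; congr (_%:C).
    by rewrite mulrA divfK // lt0r_neq0.
  have v0 : v != 0.
    apply/eqP => v0; have : row i U = 0.
      apply/rowP => x; rewrite !mxE; move/rowP/(_ x): v0; rewrite !mxE => /eqP.
      rewrite mulf_eq0 => /orP[/eqP //|].
      rewrite -(rmorph0 (real_complex R)) => /eqP/complexI/eqP.
      by rewrite gt_eqF.
    have := row_unitarymxP UU i i => + r0; rewrite r0 eqxx linear0l => /eqP.
    by rewrite eq_sym oner_eq0.
  have ev : eigenvalue PC (d 0 i) by apply/eigenvalueP; exists v.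
  have [d1|d1] := eqVneq (d 0 i) 1; last first.
    rewrite normrM mulrC ler_wpM2r // norm_normc lecR; apply: nontrivial_le_gap.
    by rewrite /nontrivial_eigenvalue ev d1.
  (* The gap does not control the eigenvalue 1, but its eigenvector is a multiple of [s], and
     pairing that with [phi] gives a multiple of the mean of [f], which is 0. *)
  suff -> : c 0 i = 0 by rewrite mul0r normr0 mulr0.
  have vfix : v *m PC = v by rewrite vP d1 scale1r.
  (* [P] is real, so the real and imaginary parts of [v] are each fixed by [P] and proportional to
     [pi]. *)
  have part (F : {additive R[i] -> R}) :
      (forall (w : R[i]) (r : R), F (w * r%:C) = F w * r) ->
      exists k, forall x, F (v 0 x) = k * pi 0 x.
    move=> FM; pose mu := \row_x F (v 0 x).
    have muP : mu *m P = mu.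
      apply/rowP => y.
      have e : v 0 y = \sum_x v 0 x * (P x y)%:C.
        by rewrite -{1}vfix mxE; apply: eq_bigr => x _; congr (_ * _); rewrite mxE.
      rewrite [RHS]mxE e raddf_sum mxE; apply: eq_bigr => x _.
      by rewrite FM; congr (_ * _); rewrite mxE.
    have [k kE] := left_fixed_proportional muP.
    by exists k => x; rewrite -kE [RHS]mxE.
  have [k1 k1E] := part (@complex.Re R) (ltac:(by case=> a b r /=; rewrite mulr0 subr0)).
  have [k2 k2E] := part (@complex.Im R) (ltac:(by case=> a b r /=; rewrite mulr0 add0r)).
  have vE x : v 0 x = (k1 +i* k2) * (pi 0 x)%:C.
    by rewrite [LHS]complexE k1E k2E; simpc.
  have UE x : U i x = (k1 +i* k2) * (s x)%:C.
    have s0 : (s x)%:C != 0 by rewrite (inj_eq (@complexI R) _ 0) gt_eqF.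
    apply: (mulIf s0); rewrite -mulrA -rmorphM -expr2 s_sqr -vE mxE //.
  have UC x : Num.conj (U i x) = Num.conj (k1 +i* k2) * (s x)%:C.
    by rewrite UE rmorphM; congr (_ * _); apply/CrealP; rewrite complex_real.
  rewrite /c mxE (eq_bigr (fun x => Num.conj (k1 +i* k2) * (pi 0 x * f x)%:C)) => [|x _].
    by rewrite -mulr_sumr -rmorph_sum f0 rmorph0 mulr0.
  rewrite !mxE UC mulrCA -rmorphM; congr (_ * _%:C).
  by rewrite -s_sqr; ring.
have normsq (w : 'rV[R[i]]_N.+1) : \sum_x `|w 0 x| ^+ 2 = (w *m w^t*) 0 0.
  by rewrite mxE; apply: eq_bigr => x _; rewrite normCK !mxE.
have normU (w : 'rV[R[i]]_N.+1) : \sum_x `|(w *m U) 0 x| ^+ 2 = \sum_x `|w 0 x| ^+ 2.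
  rewrite !normsq trmx_mul map_mxM mulmxA -(mulmxA w) (unitarymxP UU) mulmx1.
  by [].
have phiE : phi = c *m U by rewrite mulmxKtV.
have phiA : phi *m A = c *m diag_mx d *m U.
  by rewrite {1}phiE {1}AE !mulmxA mulmxK // spectral_unit.
have Lhs : \sum_x `|(phi *m A) 0 x| ^+ 2 = (\sum_x pi 0 x * (\sum_y P x y * f y) ^+ 2)%:C.
  rewrite rmorph_sum; apply: eq_bigr => y _.
  have -> : (phi *m A) 0 y = (s y * \sum_x P y x * f x)%:C.
    rewrite mulr_sumr rmorph_sum mxE; apply: eq_bigr => x _.
    rewrite !mxE -rmorphM; congr (_%:C).
    have /lt0r_neq0 sy := s_gt0 y; apply: (mulIf sy).
    have -> : s x * f x * (s x * P x y / s y) * s y = s x ^+ 2 * P x y * f x by field.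
    by rewrite s_sqr reversible -s_sqr; ring.
  by rewrite norm_real -rmorphXn real_normK ?num_real // exprMn s_sqr.
have Rhs : \sum_x `|phi 0 x| ^+ 2 = (\sum_x pi 0 x * f x ^+ 2)%:C.
  rewrite rmorph_sum; apply: eq_bigr => y _.
  by rewrite mxE norm_real -rmorphXn real_normK ?num_real // exprMn s_sqr.
rewrite -lecR rmorphM rmorphXn /= -Lhs -Rhs phiA phiE !normU mulr_sumr.
apply: ler_sum => i _; rewrite -exprMn ler_pXn2r ?nnegrE //.
  by rewrite mul_mx_diag mxE.
by rewrite mulr_ge0 // lecR; have := gap_le1; lra.
Qed.

Lemma l2_contraction t (f : 'I_N.+1 -> R) : \sum_x pi 0 x * f x = 0 ->
  \sum_x pi 0 x * (\sum_y (P ^+ t) x y * f y) ^+ 2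
    <= (1 - gap P) ^+ (t * 2) * \sum_x pi 0 x * f x ^+ 2.
Proof.
have one g x : \sum_y (P ^+ 0) x y * g y = g x :> R.
  rewrite expr0 (bigD1 x) //= mxE eqxx mul1r big1 ?addr0 // => y yx.
  by rewrite mxE eq_sym (negbTE yx) mul0r.
elim: t f => [|t IH] f f0.
  by rewrite mul0n expr0 mul1r; under eq_bigr do rewrite one.
pose g x := \sum_y P x y * f y.
have g0 : \sum_x pi 0 x * g x = 0.
  rewrite -[RHS]f0 /g; under eq_bigr do rewrite mulr_sumr.
  rewrite exchange_big /=; apply: eq_bigr => y _.
  case: pi_stat => _ _ /rowP/(_ y); rewrite mxE => <-.
  by rewrite mulr_suml; apply: eq_bigr => x _; rewrite mulrA.
have E x : \sum_y (P ^+ t.+1) x y * f y = \sum_y (P ^+ t) x y * g y.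
  under eq_bigr do rewrite mx_powS mxE mulr_suml.
  rewrite exchange_big /=; apply: eq_bigr => z _; rewrite mulr_sumr.
  by apply: eq_bigr => y _; rewrite mulrA.
under eq_bigr do rewrite E.
apply: le_trans (IH g g0) _; rewrite mulSn addnC exprD -mulrA.
rewrite ler_wpM2l ?l2_contraction_step //.
by rewrite mulnC exprM exprn_ge0 // sqr_ge0.
Qed.

End Spectrum.

(** * Distance to stationarity *)

(** Two-sided Chebyshev inequality, cleared of denominators, for the survival function [G] of a time
    with mean [m] and variance at most [2 * K * m]. *)
Definition concentrated (R : realFieldType) (K m : R) (G : nat -> R) :=
  forall t : nat, (m <= t%:R -> (t%:R - m) ^+ 2 * G t <= 2 * K * m) /\
    (t%:R <= m -> (m - t%:R) ^+ 2 * (1 - G t) <= 2 * K * m).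

(** * Deviation of the tails from one endpoint *)

Section OneSided.
Variables (R : realType) (N : nat) (P : 'M[R]_N.+1) (pi : 'rV[R]_N.+1).
Hypothesis P_bd : birth_death P.
Hypothesis P_lazy : lazy P.
Hypothesis P_irr : irreducible P.
Hypothesis pi_stat : stationary_distribution P pi.

Let g := gap P.
Let g_gt0 : 0 < g. Proof. exact: (gap_gt0 P_bd P_lazy). Qed.
Let g_le1 : g <= 1. Proof. exact: (gap_le1 P_bd P_lazy). Qed.
Let pi_gt0 x : 0 < pi 0 x. Proof. exact: (stationary_gt0 P_bd P_irr pi_stat). Qed.
Let d := dist_to_stationarity P pi.

(** Cauchy-Schwarz and the L2 contraction bound the pairing of [f] with [P f] by [1 - g] times the
    squared norm of [f]. *)
Lemma poincare (phi : nat -> R) :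
  \sum_(0 <= x < N.+1) pi 0 (inord x) * phi x = 0 ->
  \sum_(0 <= x < N.+1) pi 0 (inord x) * phi x ^+ 2
    <= g^-1 * \sum_(1 <= j < N.+1) pi 0 (inord j) * down P j * (phi j - phi j.-1) ^+ 2.
Proof.
pose f (x : 'I_N.+1) := phi x.
have nat2ord (F : R -> R) : \sum_(0 <= x < N.+1) pi 0 (inord x) * F (phi x) =
    \sum_x pi 0 x * F (f x).
  by rewrite big_mkord; apply: eq_bigr => x _; rewrite inord_val.
rewrite (nat2ord id) (nat2ord (fun r => r ^+ 2)) => f0.
have -> : \sum_(1 <= j < N.+1) pi 0 (inord j) * down P j * (phi j - phi j.-1) ^+ 2 =
   \sum_(1 <= j < N.+1) pi 0 (inord j) * down P j * (f (inord j) - f (inord j.-1)) ^+ 2.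
  apply: eq_big_nat => j /andP[j0 jN]; rewrite /f !inordK //.
  by rewrite (leq_ltn_trans (leq_pred _)).
rewrite -(dirichlet_form P_bd pi_stat).
have := l2_contraction_step P_bd P_lazy P_irr pi_stat f0; rewrite -/g.
set B := \sum_x pi 0 x * f x ^+ 2; set X := \sum_x _ * (\sum_y _).
set C := \sum_x _ => CB.
rewrite ler_pdivlMl //.
suff : X <= (1 - g) * B by lra.
(* The AM-GM step below divides by [1 - g]; for [g = 1] the contraction gives [P f = 0] instead. *)
have [g1|g1] := eqVneq g 1.
  have C0 : C <= 0 by move: CB; rewrite g1 subrr expr0n mul0r.
  rewrite g1 subrr mul0r /X big1 // => x _.
  suff -> : \sum_y P x y * f y = 0 by rewrite mulr0.
  have Cp z : 0 <= pi 0 z * (\sum_y P z y * f y) ^+ 2 by rewrite mulr_ge0 ?sqr_ge0 // ltW.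
  have : C == 0 by rewrite eq_le C0 sumr_ge0.
  rewrite psumr_eq0 // => /allP/(_ x); rewrite mem_index_enum => /(_ isT).
  by rewrite mulf_eq0 gt_eqF //= sqrf_eq0 => /eqP.
have l0 : 0 < 1 - g by rewrite subr_gt0 lt_neqAle g1.
suff : (1 - g) * X * 2 <= (1 - g) ^+ 2 * B + C.
  move=> H; rewrite -(ler_pM2l l0); move: H CB; rewrite expr2 -!mulrA; lra.
rewrite /X /B /C mulr_sumr !mulr_suml mulr_sumr -big_split /=; apply: ler_sum => x _.
set Y := \sum_y _; rewrite -subr_ge0.
have -> : (1 - g) ^+ 2 * (pi 0 x * f x ^+ 2) + pi 0 x * Y ^+ 2 - (1 - g) * (pi 0 x * f x * Y) * 2
  = pi 0 x * ((1 - g) * f x - Y) ^+ 2 by ring.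
by rewrite mulr_ge0 ?sqr_ge0 // ltW.
Qed.

Lemma tail_concentration j : (j <= N)%N -> exists2 m : R, 0 <= m &
  concentrated g^-1 m (fun t => (tail pi j - tail (row 0 (P ^+ t)) j) / tail pi j).
Proof.
move=> jN.
have gi : 0 < g^-1 by rewrite invr_gt0.
have pi1 : tail pi 0 = 1 by rewrite tail0; case: pi_stat.
have r1 t : tail (row 0 (P ^+ t)) 0 = 1.
  by rewrite tail0; under eq_bigr do rewrite mxE; rewrite pow_row.
have := @dual_concentration R N (up P) (down P) (fun x => pi 0 (inord x)) g^-1
  (fun j _ => pi_gt0 _) (up_gt0 P_bd P_irr) (down_gt0 P_bd P_irr pi_stat)
  (detailed_balance P_bd pi_stat) (up_half P_bd P_lazy) (down_half P_bd P_lazy) gi poincare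
  (fun t j => tail pi j - tail (row 0 (P ^+ t)) j) _ _ _ _ j jN.
move=> /(_ _ _ _ _)[|t|t|t i iN|m m0 H].
- move=> i /andP[i0 iN]; rewrite -tail_nat [X in _ - X](_ : _ = 0) ?subr0 //.
  rewrite /tail big1 // => x ix; rewrite expr0 !mxE.
  by case: eqP ix => // <- /=; rewrite leqNgt i0.
- by rewrite pi1 r1 subrr.
- by rewrite !tail_out ?subrr.
- have e : tail pi i - tail (row 0 (P ^+ t.+1)) i = tail ((pi - row 0 (P ^+ t)) *m P) i.
    by rewrite mulmxBl tailB -row_mul -mx_powS; case: pi_stat => _ _ ->.
  have E k : (k <= N)%N -> (pi - row 0 (P ^+ t)) 0 (inord k) =
     tail pi k - tail (row 0 (P ^+ t)) k - (tail pi k.+1 - tail (row 0 (P ^+ t)) k.+1).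
    move=> kN; rewrite -!tailB.
    by have := tailS (pi - row 0 (P ^+ t)) (inord k); rewrite inordK // => ->; rewrite addrK.
  rewrite e tail_step // !E.
  + rewrite prednK; last by case/andP: iN.
    by rewrite tailB; ring.
  + by case/andP: iN.
  + by case/andP: iN => _; apply: leq_trans; exact: leq_pred.
by exists m => // t; have := H t; rewrite -tail_nat.
Qed.

(** If the bound failed at [a], monotonicity would make it fail at every state up to [a], a set of
    mass at least [delta]; this contradicts the L2 contraction of the centred indicator of the
    states [>= k]. *)
Lemma tail_pow_ge (delta r : R) s k a : 0 < delta -> 0 <= r ->
  (1 - g) ^+ (s * 2) <= delta * r ^+ 2 -> (a <= N)%N -> tail pi a.+1 <= 1 - delta ->
  tail pi k - r <= tail (row (inord a) (P ^+ s)) k.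
Proof.
move=> d0 r0 sr aN qa.
have [p0 p1 _] := pi_stat.
pose h x := tail (row x (P ^+ s)) k.
rewrite leNgt; apply/negP => lt_h.
pose f (x : 'I_N.+1) := (k <= x)%N%:R - tail pi k.
have tailf : \sum_x pi 0 x * (k <= x)%N%:R = tail pi k.
  by rewrite /tail [RHS]big_mkcond; apply: eq_bigr => x _; case: leqP; rewrite ?mulr1 ?mulr0.
have f0 : \sum_x pi 0 x * f x = 0.
  under eq_bigr do rewrite mulrBr.
  by rewrite sumrB tailf -mulr_suml p1 mul1r subrr.
have fh x : \sum_y (P ^+ s) x y * f y = h x - tail pi k.
  under eq_bigr do rewrite mulrBr.
  rewrite sumrB -mulr_suml pow_row // mul1r; congr (_ - _).
  rewrite /h /tail [RHS]big_mkcond; apply: eq_bigr => y _; rewrite mxE.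
  by case: leqP; rewrite ?mulr1 ?mulr0.
have := l2_contraction P_bd P_lazy P_irr pi_stat s f0; rewrite -/g.
apply/negP; rewrite -ltNge.
have tail01 : 0 <= tail pi k <= 1.
  rewrite sumr_ge0 //= -p1 /tail [leLHS]big_mkcond; apply: ler_sum => x _.
  by case: ifP.
have f_le : \sum_x pi 0 x * f x ^+ 2 <= 1.
  rewrite -p1; apply: ler_sum => x _; rewrite ler_piMr //.
  by rewrite /f; case: leqP => _ /=; move: tail01 => /andP[]; nra.
apply: le_lt_trans (_ : delta * r ^+ 2 < _).
  by apply: le_trans sr; rewrite ler_piMr // mulnC exprM exprn_ge0 // sqr_ge0.
have low (x : 'I_N.+1) : (x <= a)%N -> r < tail pi k - h x.
  move=> xa; have := @tail_pow_mono _ _ P P_bd P_lazy s k x (inord a).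
  by rewrite inordK // => /(_ xa); rewrite -/(h x); move: lt_h; lra.
have head : delta <= \sum_(x < N.+1 | (x <= a)%N) pi 0 x.
  have := p1; rewrite (bigID (fun x : 'I_N.+1 => (x <= a)%N)) /=.
  have -> : \sum_(x < N.+1 | ~~ (x <= a)%N) pi 0 x = tail pi a.+1.
    by apply: eq_bigl => x; rewrite ltnNge.
  by move: qa; lra.
under eq_bigr do rewrite fh.
rewrite (bigID (fun x : 'I_N.+1 => (x <= a)%N)) /=.
apply: le_lt_trans (_ : (\sum_(x < N.+1 | (x <= a)%N) pi 0 x) * r ^+ 2 < _).
  by rewrite ler_wpM2r ?sqr_ge0.
rewrite mulr_suml.
apply: (@lt_le_trans _ _
  (\sum_(x < N.+1 | (x <= a)%N) pi 0 x * (h x - tail pi k) ^+ 2)).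
  apply: ltr_sum => [|x /low xr].
    by apply/hasP; exists 0; rewrite ?mem_index_enum.
  by rewrite ltr_pM2l //; move: xr r0; nra.
by rewrite lerDl sumr_ge0 // => x _; rewrite mulr_ge0 ?sqr_ge0.
Qed.

Lemma one_sided_profile (kappa : R) : 0 < kappa < 1 -> exists (m : R) (G : nat -> R),
  [/\ 0 <= m, forall t, 0 <= G t, concentrated g^-1 m G,
      forall t, (1 - kappa ^+ 2) * G t <= d t &
      forall t s k, (1 - g) ^+ s <= kappa ^+ 2 ->
        tail pi k - tail (row 0 (P ^+ (t + s))) k <= G t + kappa *+ 2].
Proof.
move=> /andP[k0 k1].
have [p0 p1 _] := pi_stat.
have kk : 0 < kappa ^+ 2 < 1 by rewrite exprn_gt0 //= exprn_ilt1 // ltW.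
(* The least such [a] is a low quantile: the states up to [a] have mass at least [kappa^2], those
   from [a] on at least [1 - kappa^2]. *)
have ex_a : exists a, tail pi a.+1 <= 1 - kappa ^+ 2.
  by exists N; rewrite tail_out //; lra.
case: (ex_minnP ex_a) => a qa amin.
have aN : (a <= N)%N by apply: amin; rewrite tail_out //; lra.
have ha : 1 - kappa ^+ 2 <= tail pi a.
  case: a {qa} amin aN => [|a] amin _; first by rewrite tail0 p1; lra.
  rewrite leNgt; apply/negP => /ltW/amin; by rewrite ltnn.
have [m m0 conc] := tail_concentration aN.
have h0 : 0 < tail pi a by lra.
exists m, (fun t => (tail pi a - tail (row 0 (P ^+ t)) a) / tail pi a).
have D0 t : 0 <= tail pi a - tail (row 0 (P ^+ t)) a.
  by rewrite subr_ge0 (tail_0_stationary P_bd P_lazy pi_stat).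
have G0 t : 0 <= (tail pi a - tail (row 0 (P ^+ t)) a) / tail pi a.
  by rewrite divr_ge0 // ltW.
split=> // [t|t s k sP].
  apply: le_trans (dist_ge_tail P_bd pi_stat t 0 a).
  rewrite mulrA ler_pdivrMr // mulrC ler_wpM2l //.
set Gt := _ / _; set mu := row 0 (P ^+ t).
have E : tail (row 0 (P ^+ (t + s))) k = \sum_y mu 0 y * tail (row y (P ^+ s)) k.
  rewrite exprD row_mul tail_mul; apply: eq_bigr => y _; congr (_ * _).
  by rewrite /tail; apply: eq_bigr => z _; rewrite mxE.
have mu0 y : 0 <= mu 0 y by rewrite mxE pow_ge0.
have t0 y : 0 <= tail (row y (P ^+ s)) k by apply: sumr_ge0 => z _; rewrite mxE pow_ge0.
pose h := tail (row (inord a) (P ^+ s)) k.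
(* Restart at time [t], keeping only the mass at or above [a]; by monotonicity its tails are at
   least those from [a]. *)
have low : tail mu a * h <= tail (row 0 (P ^+ (t + s))) k.
  rewrite E (bigID (fun y : 'I_N.+1 => (a <= y)%N)) /= ler_wpDr ?sumr_ge0 // => [|].
    by move=> y _; rewrite mulr_ge0.
  rewrite /tail mulr_suml; apply: ler_sum => y ay; rewrite ler_wpM2l //.
  by apply: tail_pow_mono => //; rewrite inordK.
have muE : tail mu a = tail pi a * (1 - Gt).
  by rewrite /Gt mulrBr mulr1 mulrC divfK ?gt_eqF //; ring.
(* Here [delta * r^2] is [kappa^4], the square of the bound assumed on [(1 - g)^s]. *)
have hpi : tail pi k - kappa <= h.
  apply: (@tail_pow_ge (kappa ^+ 2)) => //; [by case/andP: kk|exact: ltW|].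
  rewrite exprM -expr2 ler_pXn2r ?nnegrE ?exprn_ge0 //; first by rewrite subr_ge0.
  exact: ltW.
have pk1 : tail pi k <= 1.
  rewrite -p1 /tail [leLHS]big_mkcond; apply: ler_sum => x _; by case: ifP.
have G1 : Gt <= 1.
  rewrite ler_pdivrMr // mul1r lerBlDr lerDl; exact: sumr_ge0.
have kk' : kappa ^+ 2 <= kappa by rewrite ler_iXnr // ltW.
have h_ge0 : 0 <= h := t0 _.
have ha1 : (1 - kappa ^+ 2) * (1 - Gt) * h <= tail (row 0 (P ^+ (t + s))) k.
  by apply: le_trans low; rewrite muE ler_wpM2r // ler_wpM2r // subr_ge0.
have Gt0 : 0 <= Gt := G0 t.
have : h - kappa ^+ 2 - Gt <= (1 - kappa ^+ 2) * (1 - Gt) * h.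
  have h1 : h <= 1.
    have [q0 q1] := prob_pow P_bd s (inord a).
    rewrite /h -q1 /tail [leLHS]big_mkcond; apply: ler_sum => x _; by case: ifP.
  have : (kappa ^+ 2 + Gt) * h <= kappa ^+ 2 + Gt by rewrite ler_piMr // addr_ge0 ?sqr_ge0.
  have : 0 <= kappa ^+ 2 * Gt * h by rewrite mulr_ge0 // mulr_ge0 // sqr_ge0.
  by lra.
by lra.
Qed.

End OneSided.

(** * Reversal of the state space, to treat the other endpoint *)

Section Reflection.
Variables (R : realType) (N : nat).
Implicit Types (P : 'M[R]_N.+1) (mu pi : 'rV[R]_N.+1).

Definition reflect_mx P : 'M[R]_N.+1 := \matrix_(x, y) P (rev_ord x) (rev_ord y).
Definition reflect_row (T : Type) (mu : 'rV[T]_N.+1) : 'rV[T]_N.+1 := \row_x mu 0 (rev_ord x).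

Lemma reflect_mxK : involutive reflect_mx.
Proof. by move=> P; apply/matrixP => x y; rewrite !mxE !rev_ordK. Qed.

Lemma sum_rev (T : nmodType) (F : 'I_N.+1 -> T) : \sum_x F (rev_ord x) = \sum_x F x.
Proof. by rewrite [RHS](reindex_inj rev_ord_inj). Qed.

Lemma reflect_mul (T : pzSemiRingType) (mu : 'rV[T]_N.+1) (A : 'M[T]_N.+1) :
  reflect_row mu *m \matrix_(x, y) A (rev_ord x) (rev_ord y) = reflect_row (mu *m A).
Proof.
apply/rowP => y; rewrite !mxE -[RHS]sum_rev; apply: eq_bigr => x _.
by rewrite !mxE.
Qed.

Lemma reflect_pow P t : reflect_mx P ^+ t = reflect_mx (P ^+ t).
Proof.
elim: t => [|t IH].
  by apply/matrixP => x y; rewrite !mxE (inj_eq rev_ord_inj).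
rewrite !exprSr IH; apply/matrixP => x y; rewrite !mxE -[RHS]sum_rev.
by apply: eq_bigr => z _; rewrite !mxE.
Qed.

Lemma birth_death_reflect P : birth_death P -> birth_death (reflect_mx P).
Proof.
case=> N1 [P0 P1] band; split=> //; first split=> [x y|x].
- by rewrite mxE.
- by under eq_bigr do rewrite mxE; rewrite (sum_rev (P (rev_ord x))).
- move=> x y xy; rewrite mxE band //=.
  by move: xy (ltn_ord x) (ltn_ord y); lia.
Qed.

Lemma lazy_reflect P : lazy P -> lazy (reflect_mx P).
Proof. by move=> l x; rewrite mxE. Qed.

Lemma irreducible_reflect P : irreducible P -> irreducible (reflect_mx P).
Proof.
move=> irr x y; have [t Pt] := irr (rev_ord x) (rev_ord y).
by exists t; rewrite reflect_pow mxE.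
Qed.

Lemma stationary_reflect P pi : stationary_distribution P pi ->
  stationary_distribution (reflect_mx P) (reflect_row pi).
Proof.
case=> p0 p1 pP; split=> [x||]; first by rewrite mxE.
  by under eq_bigr do rewrite mxE; rewrite (sum_rev (fun x => pi 0 x)).
by rewrite reflect_mul pP.
Qed.

Lemma nontrivial_eigenvalue_reflect P z :
  nontrivial_eigenvalue P z -> nontrivial_eigenvalue (reflect_mx P) z.
Proof.
move=> /andP[/eigenvalueP[v vP v0] z1]; rewrite /nontrivial_eigenvalue z1 andbT.
apply/eigenvalueP; exists (reflect_row v).
  have -> : map_mx (real_complex R) (reflect_mx P) =
    \matrix_(x, y) (map_mx (real_complex R) P) (rev_ord x) (rev_ord y).
    by apply/matrixP => x y; rewrite !mxE.
  by rewrite reflect_mul vP; apply/rowP => x; rewrite !mxE.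
apply: contraNneq v0 => v0; apply/eqP/rowP => x; rewrite mxE.
by move/rowP/(_ (rev_ord x)): v0; rewrite !mxE rev_ordK.
Qed.

Lemma gap_reflect P : gap (reflect_mx P) = gap P.
Proof.
have E : nontrivial_eigenvalue (reflect_mx P) = nontrivial_eigenvalue P.
  apply/funext => z; apply/idP/idP; last exact: nontrivial_eigenvalue_reflect.
  by move/nontrivial_eigenvalue_reflect; rewrite reflect_mxK.
by rewrite /gap E.
Qed.

Lemma dist_reflect P pi t :
  dist_to_stationarity (reflect_mx P) (reflect_row pi) t = dist_to_stationarity P pi t.
Proof.
rewrite /dist_to_stationarity [RHS](reindex_inj rev_ord_inj) /=.
apply: eq_bigr => x _; congr (_ * _); rewrite -[RHS]sum_rev; apply: eq_bigr => y _.
by rewrite reflect_pow !mxE.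
Qed.

Lemma tail_reflect mu k : \sum_x mu 0 x = 1 ->
  tail (reflect_row mu) (N.+1 - k) = 1 - tail mu k.
Proof.
move=> m1; rewrite -m1 (bigID (fun x : 'I_N.+1 => (k <= x)%N)) /= addrC addrK.
rewrite /tail [RHS](reindex_inj rev_ord_inj) /=.
apply: eq_big => x; last by rewrite mxE.
by have := ltn_ord x; lia.
Qed.

End Reflection.

Lemma two_sided_profile (R : realType) (N : nat) (P : 'M[R]_N.+1) (pi : 'rV[R]_N.+1) (kappa : R) :
  birth_death P -> lazy P -> irreducible P -> stationary_distribution P pi ->
  0 < kappa < 1 ->
  exists (m1 m2 : R) (G1 G2 : nat -> R),
  [/\ [/\ 0 <= m1, forall t, 0 <= G1 t, concentrated (t_rel P) m1 G1 &
          forall t, (1 - kappa ^+ 2) * G1 t <= dist_to_stationarity P pi t],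
      [/\ 0 <= m2, forall t, 0 <= G2 t, concentrated (t_rel P) m2 G2 &
          forall t, (1 - kappa ^+ 2) * G2 t <= dist_to_stationarity P pi t] &
      forall t s, (1 - gap P) ^+ s <= kappa ^+ 2 ->
        dist_to_stationarity P pi (t + s) <= G1 t + G2 t + kappa *+ 4].
Proof.
move=> bd lz irr st kk.
have [m1 [G1 [m10 G10 c1 l1 u1]]] := one_sided_profile bd lz irr st kk.
have [m2 [G2 [m20 G20 c2 l2 u2]]] := one_sided_profile (birth_death_reflect bd)
  (lazy_reflect lz) (irreducible_reflect irr) (stationary_reflect st) kk.
rewrite gap_reflect in c2 u2.
exists m1, m2, G1, G2; split; [by []|split=> // t|move=> t s sP].
  by rewrite -dist_reflect.
have -> : G1 t + G2 t + kappa *+ 4 = (G1 t + kappa *+ 2) + (G2 t + kappa *+ 2) by ring.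
apply: dist_le_tails => // k; first exact: u1.
(* Reflection exchanges upper tails and heads, hence the threshold [N.+1 - k] and the change of
   sign. *)
have := u2 t s (N.+1 - k)%N sP.
have -> : row 0 (reflect_mx P ^+ (t + s)) = reflect_row (row ord_max (P ^+ (t + s))).
  apply/rowP => x; rewrite reflect_pow !mxE; congr (_ _ _).
  by apply: val_inj; rewrite /= subn1.
have [_ r1] := prob_pow bd (t + s) ord_max.
have [_ pi1 _] := st.
by rewrite !tail_reflect // opprB addrC addrA subrK addrC.
Qed.

(** * Mixing times and cutoff *)

(** Chebyshev is used three times. At [T] it gives [m <= 10 T], hence [K m <= 10 w^2]; at [t1] it
    gives [m <= t1 + 7 w / eps]; at [t], at least [13 w / eps] past [m], it gives
    [G t <= 20 eps^2 / 169]. *)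
Lemma concentrated_decay (R : realFieldType) (K m w eps : R) (G : nat -> R) (T t1 : nat) :
  0 < eps < 1 -> 0 < K -> K <= 2 * T%:R -> 0 <= m -> 0 < w -> w ^+ 2 = T%:R * K ->
  concentrated K m G -> (forall t, 0 <= G t) ->
  G T <= 2^-1 -> G t1 <= 1 - eps / 2 ->
  forall t : nat, t1%:R + 20 / eps * w <= t%:R -> G t <= eps / 8.
Proof.
move=> /andP[e0 e1] K0 KT m0 w0 wE conc G0 GT Gt1 t tt.
set y := w / eps; have wy : w = eps * y by rewrite /y mulrC divfK // gt_eqF.
have y0 : 0 < y by rewrite divr_gt0.
have tty : t1%:R + 20 * y <= t%:R by move: tt; rewrite /y mulrAC -mulrA.
have m10 : m <= 10 * T%:R.
  have [mT|Tm] := leP m T%:R; first by have : 0 <= T%:R :> R by []; lra.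
  have [_ /(_ (ltW Tm)) c] := conc T.
  have h : (m - T%:R) ^+ 2 <= 4 * K * m.
    have : (m - T%:R) ^+ 2 * 2^-1 <= (m - T%:R) ^+ 2 * (1 - G T).
      by rewrite ler_wpM2l ?sqr_ge0 //; lra.
    by lra.
  have h2 : K * m <= 2 * T%:R * m by rewrite ler_wpM2r.
  (* The bound [(m - T)^2 <= 8 T m] is impossible for [m > 10 T]. *)
  rewrite leNgt; apply/negP => mT.
  have : 0 <= T%:R :> R by [].
  have : 0 < m * (m - 10 * T%:R).
    by rewrite mulr_gt0 ?subr_gt0 // (le_lt_trans _ Tm).
  by move: h h2; nra.
have Km : K * m <= 10 * w ^+ 2.
  by have := ler_wpM2l (ltW K0) m10; rewrite wE; lra.
have mt1 : m <= t1%:R + 7 * y.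
  rewrite leNgt; apply/negP => lt_m.
  have t1m : t1%:R <= m by lra.
  have [_ /(_ t1m) c] := conc t1.
  have h1 : (7 * y) ^+ 2 <= (m - t1%:R) ^+ 2 by rewrite ler_pXn2r ?nnegrE //; lra.
  have h2 : (m - t1%:R) ^+ 2 * (eps / 2) <= (m - t1%:R) ^+ 2 * (1 - G t1).
    by rewrite ler_wpM2l ?sqr_ge0 //; lra.
  have h3 : (7 * y) ^+ 2 * (eps / 2) <= (m - t1%:R) ^+ 2 * (eps / 2).
    by rewrite ler_wpM2r //; lra.
  have h4 : eps * (eps * y ^+ 2) <= eps * y ^+ 2 by rewrite ler_piMl ?ltW // mulr_gt0 // exprn_gt0.
  have h5 : 0 < eps * y ^+ 2 by rewrite mulr_gt0 // exprn_gt0.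
  by move: c Km; rewrite wy; lra.
have mt : 13 * y <= t%:R - m by lra.
have tm : m <= t%:R by lra.
have [/(_ tm) c _] := conc t.
have h1 : (13 * y) ^+ 2 * G t <= (t%:R - m) ^+ 2 * G t.
  by rewrite ler_wpM2r // ler_pXn2r ?nnegrE //; lra.
have y2 : 0 < y ^+ 2 by rewrite exprn_gt0.
have h2 : y ^+ 2 * (169 * G t) <= y ^+ 2 * (20 * eps ^+ 2).
  by move: c Km h1; rewrite wy; lra.
rewrite ler_pM2l // in h2.
have : eps ^+ 2 <= eps by rewrite ler_iXnr // ltW.
by lra.
Qed.

Lemma bernoulli_le (R : realFieldType) (g : R) (n : nat) : 0 <= g -> g <= 1 ->
  1 - g * n%:R <= (1 - g) ^+ n.
Proof.
move=> g0 g1; elim: n => [|n IH]; first by rewrite mulr0 subr0 expr0.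
rewrite exprS -natr1; have x0 : 0 <= n%:R :> R by [].
have := ler_wpM2l (_ : 0 <= 1 - g) IH; rewrite subr_ge0 => /(_ g1).
have := mulr_ge0 (sqr_ge0 g) x0.
by move: (n%:R) ((1 - g) ^+ n) => x y; lra.
Qed.

Lemma exists_nat_between (R : archiRealDomainType) (x : R) : 0 <= x ->
  exists n : nat, x <= n%:R <= x + 1.
Proof.
move=> x0; exists (Num.truncn x).+1.
have /andP[h1 h2] := truncn_itv x0.
by rewrite ltW //= -natr1 lerD2r.
Qed.

Lemma geometric_le (R : realFieldType) (g : R) (s : nat) : 0 <= g -> g <= 1 ->
  (1 - g) ^+ s * (1 + g * s%:R) <= 1.
Proof.
move=> g0 g1; elim: s => [|s IH]; first by rewrite expr0 mulr0 addr0 mulr1.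
apply: le_trans IH; rewrite exprSr -mulrA ler_wpM2l ?exprn_ge0 ?subr_ge0 //.
rewrite -natr1; have : 0 <= s%:R :> R by [].
move: (s%:R) => x x0; have : 0 <= g * (g * x + g) by rewrite mulr_ge0 ?addr_ge0 ?mulr_ge0.
by lra.
Qed.

(** [20 / eps] comes from [concentrated_decay], [128 / eps^2] from the delay [s] with
    [(1 - gap)^s <= (eps / 8)^2], and 2 from rounding up twice. *)
Definition window_const (R : realType) (eps : R) : R := 20 / eps + 128 / eps ^+ 2 + 2.

Lemma window_const_gt0 (R : realType) (eps : R) : 0 < eps -> 0 < window_const eps.
Proof.
by move=> e0; rewrite ltr_wpDl // addr_ge0 ?divr_ge0 ?sqr_ge0 // ltW.
Qed.

(** * Mixing times of a single chain *)

Section MixingTime.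
Variables (R : realType) (N : nat) (P : 'M[R]_N.+1) (pi : 'rV[R]_N.+1).
Hypothesis P_bd : birth_death P.
Hypothesis P_lazy : lazy P.
Hypothesis P_irr : irreducible P.
Hypothesis pi_stat : stationary_distribution P pi.

Let g := gap P.
Let K := t_rel P.
Let g_gt0 : 0 < g. Proof. exact: (gap_gt0 P_bd P_lazy). Qed.
Let g_le1 : g <= 1. Proof. exact: (gap_le1 P_bd P_lazy). Qed.
Let K_gt0 : 0 < K. Proof. by rewrite /K invr_gt0. Qed.
Let d := dist_to_stationarity P pi.
Let tmix := t_mix P pi.
Let T := tmix 4^-1.

Lemma t_mix_le eps t : d t <= eps -> (tmix eps <= t)%N.
Proof.
move=> dt; rewrite /tmix /t_mix; case: pselect => [ex|//].
by case: ex_minnP => n _ /(_ t dt).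
Qed.

Lemma exists_gap_pow_le (c : R) : 0 < c ->
  exists2 s : nat, (1 - g) ^+ s <= c & s%:R <= K / c + 1.
Proof.
move=> c0; have [|s /andP[s1 s2]] := @exists_nat_between R (K / c).
  by rewrite divr_ge0 ?ltW.
exists s => //; have h := @geometric_le R g s (ltW g_gt0) g_le1.
have gs : c^-1 <= g * s%:R.
  by rewrite -ler_pdivrMl // ; move: s1; rewrite /K /t_rel -/g.
have l0 : 0 <= (1 - g) ^+ s by rewrite exprn_ge0 // subr_ge0.
rewrite -[leRHS]mul1r -ler_pdivrMr //; apply: le_trans h.
by rewrite ler_wpM2l //; lra.
Qed.

(** This rules out the fallback value of [t_mix]: by Chebyshev both profiles are small at large
    times. *)
Lemma exists_dist_le eps : 0 < eps < 1 -> exists t, d t <= eps.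
Proof.
move=> /andP[e0 e1]; pose k := eps / 8.
have k01 : 0 < k < 1 by rewrite /k; apply/andP; split; lra.
have [m1 [m2 [G1 [G2 [[m10 G10 c1 _] [m20 G20 c2 _] up]]]]] :=
  two_sided_profile P_bd P_lazy P_irr pi_stat k01.
have [|s sk _] := @exists_gap_pow_le (k ^+ 2); first by rewrite exprn_gt0; case/andP: k01.
have far m G : 0 <= m -> (forall t, 0 <= G t) -> concentrated K m G ->
    exists t0 : nat, forall t, (t0 <= t)%N -> G t <= k.
  move=> m0 G0 conc.
  have k0 : 0 < k by case/andP: k01.
  have b0 : 0 <= 2 * K * m / k by rewrite divr_ge0 ?(ltW k0) // mulr_ge0 // mulr_ge0 // ltW.
  (* From this time on [t - m] is at least 1 and at least [2 K m / k], hence so is its square. *)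
  have [|t0 /andP[t1 _]] := @exists_nat_between R (m + 1 + 2 * K * m / k).
    by rewrite !addr_ge0.
  exists t0 => t; rewrite -(ler_nat R) => t0t.
  have tm : m <= t%:R by lra.
  have [/(_ tm) c _] := conc t.
  have h : 2 * K * m <= (t%:R - m) ^+ 2 * k.
    rewrite -ler_pdivrMr //; apply: (@le_trans _ _ (t%:R - m)); first by lra.
    by rewrite ler_eXnr //; lra.
  have x0 : 0 < (t%:R - m) ^+ 2 by rewrite exprn_gt0 //; lra.
  by rewrite -(ler_pM2l x0) (le_trans c).
have [t1 h1] := far _ _ m10 G10 c1; have [t2 h2] := far _ _ m20 G20 c2.
exists (maxn t1 t2 + s)%N; apply: le_trans (up _ _ sk) _.
have := h1 _ (leq_maxl t1 t2); have := h2 _ (leq_maxr t1 t2).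
by rewrite /k; lra.
Qed.

Lemma t_mixP eps : 0 < eps < 1 -> d (tmix eps) <= eps.
Proof.
move=> /exists_dist_le ex; rewrite /tmix /t_mix; case: pselect => [ex'|//].
by case: ex_minnP.
Qed.

(** The two end states differ, so one of them has stationary mass at most 1/2. *)
Lemma dist0_ge : 2^-1 <= d 0.
Proof.
have [p0 p1 _] := pi_stat.
have N0 : (0 < N)%N by case: P_bd.
have H x : 1 - pi 0 x <= d 0.
  apply: le_trans (dist_ge_tv P pi 0 x).
  rewrite /tv_dist (bigD1 x) //= expr0 !mxE eqxx.
  have -> : \sum_(i < N.+1 | i != x) `|row x 1 0 i - pi 0 i| = 1 - pi 0 x.
    have := p1; rewrite (bigD1 x) //= => <-; rewrite addrAC subrr add0r.
    apply: eq_bigr => i ix; rewrite !mxE eq_sym (negbTE ix) sub0r normrN ger0_norm //.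
  by have := ler_norm (1 - pi 0 x); rewrite /=; lra.
have := H 0; have := H ord_max.
have : pi 0 0 + pi 0 ord_max <= 1.
  rewrite -p1 (bigD1 0) //= lerD2l (bigD1 ord_max) /= ?lerDl ?sumr_ge0 //.
  by rewrite -val_eqE /= -lt0n.
by lra.
Qed.

Lemma t_mix_quarter_gt0 : (0 < T)%N.
Proof.
have e : 0 < (4^-1 : R) < 1 by apply/andP; split; lra.
rewrite lt0n; apply/eqP => T0; have := t_mixP e; rewrite -/T T0.
by have := dist0_ge; lra.
Qed.

Lemma gap_pow_le t : (1 - g) ^+ t <= 2 * d t.
Proof.
case: (gap_attained P_bd P_lazy) => [->|[z zP ->]]; last exact: eigenvalue_le_dist.
(* At time 0 the power [0 ^+ 0] is 1, and [dist0_ge] bounds it. *)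
case: t => [|t]; first by have := dist0_ge; rewrite expr0; lra.
by rewrite expr0n /= mulr_ge0 // bigmax_ge_id.
Qed.

(** By Bernoulli, [1 - g T <= (1 - g)^T <= 2 d T <= 1/2]. *)
Lemma t_rel_le_t_mix : K <= 2 * T%:R.
Proof.
have e : 0 < (4^-1 : R) < 1 by apply/andP; split; lra.
have h1 := t_mixP e; have h2 := gap_pow_le T.
have h3 := le_trans (@bernoulli_le R g T (ltW g_gt0) g_le1) h2.
rewrite -/T in h1; rewrite -(ler_pM2l g_gt0) /K /t_rel divff ?gt_eqF //.
by move: h1 h3 {h2}; move: (d T) (T%:R) => x y; lra.
Qed.

Lemma t_rel_ge1 : 1 <= K.
Proof. by rewrite /K /t_rel -/g invf_ge1. Qed.

Let w := Num.sqrt (T%:R * K).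

Lemma window_gt0 : 0 < w.
Proof. by rewrite sqrtr_gt0 mulr_gt0 // ltr0n t_mix_quarter_gt0. Qed.

(** Within [20 w / eps] after [tmix (1 - eps)] both profiles fall to [eps / 8]; after the delay [s]
    the distance is at most [2 k + 4 k < eps]. As [K <= 2 w], the delay fits in the window. *)
Lemma t_mix_window eps : 0 < eps < 1 ->
  (tmix eps)%:R - (tmix (1 - eps))%:R <= window_const eps * w.
Proof.
move=> /[dup] e01 /andP[e0 e1]; pose k := eps / 8.
have w0 := window_gt0.
have wE : w ^+ 2 = T%:R * K by rewrite sqr_sqrtr // mulr_ge0 // ltW.
have w1 : 1 <= w.
  rewrite -(@ler_pXn2r _ 2) ?nnegrE ?(ltW w0) // expr1n wE mulr_ege1 ?t_rel_ge1 //.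
  by rewrite ler1n t_mix_quarter_gt0.
have Kw : K <= 2 * w.
  rewrite -(@ler_pXn2r _ 2) ?nnegrE ?mulr_ge0 ?(ltW w0) ?(ltW K_gt0) // exprMn wE.
  have := ler_wpM2r (ltW K_gt0) t_rel_le_t_mix; have := mulr_ge0 (ler0n R T) (ltW K_gt0).
  by lra.
have k01 : 0 < k < 1 by rewrite /k; apply/andP; split; lra.
have [m1 [m2 [G1 [G2 [[m10 G10 c1 l1] [m20 G20 c2 l2] up]]]]] :=
  two_sided_profile P_bd P_lazy P_irr pi_stat k01.
have k2 : 0 < k ^+ 2 by rewrite exprn_gt0 //; case/andP: k01.
have k2e : k ^+ 2 <= eps / 64.
  have : eps ^+ 2 <= eps by rewrite ler_iXnr // ltW.
  by rewrite /k; lra.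
have [s sk sK] := exists_gap_pow_le k2.
have [|n /andP[n1 n2]] := @exists_nat_between R (20 / eps * w).
  by rewrite mulr_ge0 ?divr_ge0 ?ltW.
set t1 := tmix (1 - eps).
have dt1 : d t1 <= 1 - eps by apply: t_mixP; apply/andP; split; lra.
have dT : d T <= 4^-1 by apply: t_mixP; apply/andP; split; lra.
have decay m G : 0 <= m -> (forall t, 0 <= G t) -> concentrated K m G ->
    (forall t, (1 - k ^+ 2) * G t <= d t) -> G (t1 + n)%N <= eps / 8.
  move=> m0 G0 conc low.
  apply: (@concentrated_decay _ K m w eps G T t1) => //.
  - exact: t_rel_le_t_mix.
  (* As [k^2 <= eps / 64], dividing by [1 - k^2] turns 1/4 into at most 1/2 and, in the next item,
     [1 - eps] into at most [1 - eps / 2]. *)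
  - have := le_trans (low T) dT; have := G0 T; nra.
  - have := le_trans (low t1) dt1; have := G0 t1; nra.
  - by rewrite natrD lerD2l.
have h1 := decay _ _ m10 G10 c1 l1; have h2 := decay _ _ m20 G20 c2 l2.
have : (tmix eps <= t1 + n + s)%N.
  by apply: t_mix_le; apply: le_trans (up _ _ sk) _; rewrite /k; lra.
rewrite -(ler_nat R) !natrD => h.
have sK' : s%:R <= 128 / eps ^+ 2 * w + 1.
  apply: le_trans sK _; rewrite lerD2r.
  have -> : K / k ^+ 2 = 64 / eps ^+ 2 * K by rewrite /k; field; rewrite gt_eqF.
  have -> : 128 / eps ^+ 2 * w = 64 / eps ^+ 2 * (2 * w) by ring.
  by rewrite ler_wpM2l // divr_ge0 // sqr_ge0.
rewrite lerBlDr (le_trans h) // (le_trans (lerD (lerD (lexx _) n2) sK')) // -subr_ge0.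
suff -> : window_const eps * w + t1%:R -
    (t1%:R + (20 / eps * w + 1) + (128 / eps ^+ 2 * w + 1)) = 2 * (w - 1).
  by rewrite mulr_ge0 // subr_ge0.
by rewrite /window_const; ring.
Qed.

Lemma t_mix_antitone e1 e2 : 0 < e1 < 1 -> e1 <= e2 -> (tmix e2 <= tmix e1)%N.
Proof. by move=> e1P e12; apply: t_mix_le; apply: le_trans (t_mixP e1P) e12. Qed.

(* Laziness: one step moves the law by at most 1/2 in total variation. *)
Lemma t_mix_jump eps : 0 < eps < 4^-1 -> (0 < tmix (1 - eps))%N ->
  (tmix (1 - eps) < tmix eps)%N.
Proof.
move=> /andP[e0 e1] B0.
have e01 : 0 < eps < 1 by apply/andP; split; lra.
rewrite ltn_neqAle t_mix_antitone ?andbT //; last by lra.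
apply/eqP => AB; set B := tmix (1 - eps) in AB B0.
have dB : d B <= eps by rewrite AB t_mixP.
(* It contradicts minimality of [B], and follows from [d B.-1 <= d B + 1/2 <= eps + 1/2], as
   [eps < 1/4]. *)
suff : d B.-1 <= 1 - eps.
  by move/t_mix_le; rewrite -/B; move: B0; case: (B) => // n _; rewrite /= ltnn.
apply: bigmax_le => [|x _]; first by lra.
apply: le_trans (tv_triangle _ (row x (P ^+ B)) _) _.
have := le_trans (dist_ge_tv P pi B x) dB.
suff : tv_dist (row x (P ^+ B.-1)) (row x (P ^+ B)) <= 2^-1 by lra.
have -> : row x (P ^+ B) = row x (P ^+ B.-1) *m P by rewrite -row_mul -mx_powS prednK.
set mu := row x _.
have mu0 y : 0 <= mu 0 y by rewrite mxE pow_ge0.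
have mu1 : \sum_y mu 0 y = 1 by have [] := prob_pow P_bd B.-1 x.
rewrite /tv_dist -[leRHS]mulr1 ler_pM2l ?invr_gt0 //.
apply: le_trans (_ : \sum_y \sum_z mu 0 z * `|(z == y)%:R - P z y| <= _).
  apply: ler_sum => y _.
  have -> : mu 0 y - (mu *m P) 0 y = \sum_z mu 0 z * ((z == y)%:R - P z y).
    under [RHS]eq_bigr do rewrite mulrBr.
    rewrite sumrB [X in _ - X = _]mxE; congr (_ - _).
    rewrite (bigD1 y) //= eqxx mulr1 big1 ?addr0 // => z /negbTE ->.
    by rewrite mulr0.
  apply: le_trans (ler_norm_sum _ _ _) _; apply: ler_sum => z _.
  by rewrite normrM ger0_norm.
rewrite exchange_big /= -[leRHS]mu1; apply: ler_sum => z _.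
rewrite -mulr_sumr ler_piMr // (bigD1 z) //= eqxx.
case: P_bd => _ [P0 P1] _.
have -> : \sum_(y < N.+1 | y != z) `|(z == y)%:R - P z y| = 1 - P z z.
  rewrite -(P1 z) [in RHS](bigD1 z) //= addrAC subrr add0r.
  by apply: eq_bigr => y /negbTE yz; rewrite eq_sym yz sub0r normrN ger0_norm.
have Pz : P z z <= 1.
  by have := P1 z; rewrite (bigD1 z) //= => <-; rewrite lerDl sumr_ge0.
by rewrite ger0_norm ?subr_ge0 //; have := P_lazy z; move=> /=; lra.
Qed.

End MixingTime.

(** * Ratio of mixing times and the product of mixing time and gap *)

Section MixingRatio.
Variables (R : realType) (N : nat) (P : 'M[R]_N.+1) (pi : 'rV[R]_N.+1).
Hypothesis P_bd : birth_death P.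
Hypothesis P_lazy : lazy P.
Hypothesis P_irr : irreducible P.
Hypothesis pi_stat : stationary_distribution P pi.

Let tmix := t_mix P pi.

Lemma window_small delta : 0 < delta -> delta ^- 2 <= (tmix 4^-1)%:R * gap P ->
  Num.sqrt ((tmix 4^-1)%:R * t_rel P) <= delta * (tmix 4^-1)%:R.
Proof.
move=> d0; have g0 : 0 < gap P by apply: gap_gt0.
move: (tmix 4^-1)%:R (ler0n R (tmix 4^-1)) => T T0 dT.
have dT0 : 0 <= delta * T by rewrite mulr_ge0 // ltW.
rewrite -(ger0_norm dT0) -sqrtr_sqr ler_sqrt ?sqr_ge0 // /t_rel.
rewrite ler_pdivrMr // exprMn.
rewrite -[_ ^- 2]mulr1 ler_pdivrMl ?exprn_gt0 // in dT.
have h := ler_wpM2l T0 dT; rewrite mulr1 in h.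
by apply: le_trans h _; rewrite le_eqVlt; apply/orP; left; apply/eqP; ring.
Qed.

(** The mixing times at [eps], [1 - eps] and [4^-1] all lie between those at [1 - e0] and [e0], an
    interval of length at most [min(eta, 1) / 2] times the one at [4^-1]. *)
Lemma mixing_ratio_close (eps e0 eta : R) (c := window_const e0)
    (delta := Num.min eta 1 / (2 * c)) :
  0 < e0 -> e0 <= eps -> e0 <= 1 - eps -> e0 <= 4^-1 -> 0 < eta ->
  delta ^- 2 <= (tmix 4^-1)%:R * gap P ->
  `|1 - (tmix eps)%:R / (tmix (1 - eps))%:R| <= eta.
Proof.
move=> e00 e01 e02 e03 eta0 dT.
have e0P : 0 < e0 < 1 by apply/andP; split => //; lra.
have c0 : 0 < c by exact: window_const_gt0.
have m0 : 0 < Num.min eta 1 by rewrite lt_min eta0 ltr01.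
have [m1 m2] : Num.min eta 1 <= eta /\ Num.min eta 1 <= 1 by rewrite !ge_min !lexx orbT.
have d0 : 0 < delta by rewrite divr_gt0 // mulr_gt0.
have wT := window_small d0 dT.
have win := t_mix_window P_bd P_lazy P_irr pi_stat e0P; rewrite -/tmix -/c in win.
have anti e : e0 <= e <= 1 - e0 ->
    (tmix (1 - e0))%:R <= (tmix e)%:R :> R /\ (tmix e)%:R <= (tmix e0)%:R :> R.
  move=> /andP[h1 h2]; rewrite !ler_nat; split; apply: t_mix_antitone => //.
  by apply/andP; split; lra.
have [|a1 a2] := anti eps; first by apply/andP; split; lra.
have [|b1 b2] := anti (1 - eps); first by apply/andP; split; lra.
have [|t1 t2] := anti 4^-1; first by apply/andP; split; lra.
have T0 : 0 < (tmix 4^-1)%:R :> R by rewrite ltr0n; apply: t_mix_quarter_gt0.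
have cw : c * Num.sqrt ((tmix 4^-1)%:R * t_rel P) <= Num.min eta 1 / 2 * (tmix 4^-1)%:R.
  have -> : Num.min eta 1 / 2 * (tmix 4^-1)%:R = c * (delta * (tmix 4^-1)%:R).
    by rewrite /delta; field; rewrite gt_eqF.
  by rewrite ler_wpM2l // ltW.
move: win cw a1 a2 b1 b2 t1 t2 T0.
move: (tmix eps)%:R (tmix (1 - eps))%:R (tmix e0)%:R (tmix (1 - e0))%:R.
move: (tmix 4^-1)%:R (c * _) => T W A B hi lo.
move: m0 m1 m2; move: (Num.min eta 1) => m m0 m1 m2 win cw a1 a2 b1 b2 t1 t2 T0.
clear - eta0 m0 m1 m2 win cw a1 a2 b1 b2 t1 t2 T0.
have mT : m * T <= T by rewrite ler_piMl // ltW.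
have B0 : 0 < B by lra.
have -> : 1 - A / B = (B - A) / B by field; rewrite gt_eqF.
rewrite normrM [X in _ * X]gtr0_norm ?invr_gt0 // ler_pdivrMr //.
have h : `|B - A| <= m / 2 * T by rewrite ler_norml; apply/andP; split; lra.
apply: le_trans h _; apply: (@le_trans _ _ (m * B)); last by rewrite ler_wpM2r // ltW.
(* The cap of [eta] at 1 serves here, to compare [T] with the denominator [B]. *)
have : T <= 2 * B by lra.
by move/(ler_wpM2l (ltW m0)); lra.
Qed.

(** For a gap above 1/2 the mixing time is below [2 M], and the jump of one step is visible in the
    ratio. For a smaller gap the ratio is at least 2: otherwise [4 eps = exp(-4 M) <= (1 -
    gap)^(tmix eps) <= 2 eps]. *)
Lemma mixing_ratio_far (M eps : R) : 0 < M -> (tmix 4^-1)%:R * gap P < M ->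
  eps = expR (- (4 * M)) / 4 ->
  Num.min 1 (2 * M)^-1 <= `|1 - (tmix eps)%:R / (tmix (1 - eps))%:R|.
Proof.
move=> M0 TM epsE.
have g0 : 0 < gap P by apply: gap_gt0.
have ex1 : expR (- (4 * M)) < 1 by rewrite expR_lt1 oppr_lt0 mulr_gt0.
have ex0 := expR_gt0 (- (4 * M)).
have e0 : 0 < eps < 4^-1 by rewrite epsE; apply/andP; split; lra.
(* Division by 0 makes the ratio 0, at distance 1 from the limit. *)
have [B0|B0] := posnP (tmix (1 - eps)).
  by rewrite B0 invr0 mulr0 subr0 normr1 ge_min lexx.
have jump := t_mix_jump P_bd P_lazy P_irr pi_stat e0 B0; rewrite -/tmix in jump.
have BT : (tmix (1 - eps) <= tmix 4^-1)%N.
  apply: t_mix_antitone => //; first by apply/andP; split; lra.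
  by case/andP: e0; lra.
have eP : 0 < eps < 1 by case/andP: e0 => ? ?; apply/andP; split; lra.
rewrite -normrN opprB; apply: le_trans (ler_norm _).
have B0' : 0 < (tmix (1 - eps))%:R :> R by rewrite ltr0n.
have BT' : (tmix (1 - eps))%:R <= (tmix 4^-1)%:R :> R by rewrite ler_nat.
have jump' : (tmix (1 - eps))%:R + 1 <= (tmix eps)%:R :> R by rewrite natr1 ler_nat.
rewrite lerBrDr ler_pdivlMr // mulrDl mul1r.
have [g1|g1] := ltP 2^-1 (gap P).
  apply: le_trans jump'; rewrite addrC lerD2l.
  apply: (@le_trans _ _ ((2 * M)^-1 * (tmix (1 - eps))%:R)).
    by rewrite ler_wpM2r // ge_min lexx orbT.
  rewrite ler_pdivrMl ?mulr_gt0 // mulr1 (le_trans BT') //.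
  have : (tmix 4^-1)%:R * 2^-1 <= (tmix 4^-1)%:R * gap P by rewrite ler_wpM2l // ltW.
  by move: TM; move: (tmix 4^-1)%:R (gap P) => T g; lra.
apply: (@le_trans _ _ ((tmix (1 - eps))%:R + (tmix (1 - eps))%:R)).
  by rewrite lerD2r ler_piMl // ge_min lexx.
rewrite leNgt; apply/negP => AB.
have gA : gap P * (tmix eps)%:R <= 2 * M.
  have : gap P * (tmix eps)%:R <= gap P * ((tmix 4^-1)%:R + (tmix 4^-1)%:R).
    by rewrite ler_wpM2l ?(ltW g0) // (le_trans (ltW AB)) // lerD.
  by move: TM; move: (tmix 4^-1)%:R (tmix eps)%:R (gap P) => T A g; lra.
(* For [g <= 1/2], [exp(2 g) >= 1 + 2 g] and [(1 - g) (1 + 2 g) = 1 + g (1 - 2 g) >= 1]. *)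
have base : expR (- (2 * gap P)) <= 1 - gap P.
  rewrite expRN -[leLHS]mul1r ler_pdivrMr ?expR_gt0 //.
  apply: (@le_trans _ _ ((1 - gap P) * (1 + 2 * gap P))).
    have : 0 <= gap P * (1 - 2 * gap P) by rewrite mulr_ge0 ?(ltW g0) //; lra.
    by lra.
  by rewrite ler_wpM2l ?expR_ge1Dx //; lra.
have arg : - (4 * M) <= - (2 * gap P) * (tmix eps)%:R by lra.
have low : expR (- (4 * M)) <= (1 - gap P) ^+ tmix eps.
  apply: (@le_trans _ _ (expR (- (2 * gap P)) ^+ tmix eps)).
    by rewrite -expRM_natr ler_expR.
  by rewrite lerXn2r ?nnegrE ?expR_ge0 // subr_ge0; apply: gap_le1.
have := le_trans low (gap_pow_le P_bd P_lazy pi_stat (tmix eps)).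
have := t_mixP P_bd P_lazy P_irr pi_stat eP; rewrite -/tmix {2}epsE {low}.
by move: (dist_to_stationarity _ _ _) => dA; lra.
Qed.

End MixingRatio.

Theorem corollary2 (R : realType) (N : nat -> nat)
    (P : forall n, 'M[R]_((N n).+1)) (pi : forall n, 'rV[R]_((N n).+1))
    (P_bd : forall n, birth_death (P n))
    (P_lazy : forall n, lazy (P n))
    (P_irr : forall n, irreducible (P n))
    (pi_stat : forall n, stationary_distribution (P n) (pi n)) :
  (cutoff (fun n => t_mix (P n) (pi n)) <->
     (fun n => (t_mix (P n) (pi n) 4^-1)%:R * gap (P n)) @ \oo --> +oo) /\
  (cutoff (fun n => t_mix (P n) (pi n)) ->
     cutoff_window (fun n => t_mix (P n) (pi n))
       (fun n => Num.sqrt ((t_mix (P n) (pi n) 4^-1)%:R * t_rel (P n)))).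
Proof.
have product_condition : cutoff (fun n => t_mix (P n) (pi n)) ->
    (fun n => (t_mix (P n) (pi n) 4^-1)%:R * gap (P n)) @ \oo --> +oo.
  move=> cut; apply/cvgryPge => M0.
  (* Cutoff is used only at the level [eps] attached to [M]: wherever the product is below [M], the
     ratio stays a fixed distance from 1. *)
  pose M := Num.max M0 1.
  have M_gt0 : 0 < M by rewrite lt_max ltr01 orbT.
  pose eps : R := expR (- (4 * M)) / 4.
  have eps01 : 0 < eps < 1.
    have := expR_gt0 (- (4 * M)).
    have : expR (- (4 * M)) < 1 by rewrite expR_lt1 oppr_lt0 mulr_gt0.
    by rewrite /eps => ? ?; apply/andP; split; lra.
  have eta0 : 0 < Num.min 1 (2 * M)^-1 by rewrite lt_min ltr01 invr_gt0 mulr_gt0.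
  have /cvgrPdist_lt /(_ _ eta0) := cut eps eps01.
  apply: filterS => n; apply: contraTT; rewrite -!ltNge -leNgt => TM.
  apply: mixing_ratio_far => //.
  by rewrite (lt_le_trans TM) // le_max lexx.
split; first split=> [//|prod eps eps01].
  apply/cvgrPdist_le => eta eta0.
  move/cvgryPge: prod => prod.
  pose e0 := Num.min (Num.min eps (1 - eps)) 4^-1.
  have e00 : 0 < e0.
    by case/andP: eps01 => ? ?; rewrite !lt_min subr_gt0 invr_gt0 ltr0n andbT; apply/andP.
  have [e01 e02 e03] : [/\ e0 <= eps, e0 <= 1 - eps & e0 <= 4^-1].
    by rewrite !ge_min !lexx !orbT.
  have := prod ((Num.min eta 1 / (2 * window_const e0)) ^- 2).
  by apply: filterS => n; apply: mixing_ratio_close.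
move=> cut; split=> [|eps eps01].
  apply/eqoP => eta eta0.
  (* Once [T * gap] is at least [eta^-2], the window [sqrt(T / gap)] is at most [eta * T]. *)
  have /cvgryPge/(_ (eta ^- 2)) := product_condition cut.
  apply: filterS => n h.
  rewrite !ger0_norm ?sqrtr_ge0 //.
  exact: (window_small (P_bd n) (P_lazy n)).
exists (window_const eps); first by apply: window_const_gt0; case/andP: eps01.
by move=> n; exact: t_mix_window.
Qed.
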